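(* There exist absolute constants $c_1,c_2,c_3,C_0>0$ such that the following holds. Let $G=(V,E)$ be a connected comparison graph on $n$ nodes, let $w\in\mathbb{R}^n$ have positive entries with $\max_{i,j} w_i/w_j\le b$, let $\delta\in(0,e^{-1})$, and let $C_{n,\delta}\ge c_1\log(n/\delta)$. If $k\ge c_2 E_{\max} C_{n,\delta}^2$ and $k\ge c_3\,\Omega_{\max}\, b^2\,(1+\log(1/\delta))$, then with probability at least $1-\delta$ the estimator $\widehat W$ satisfies $$\sin(\widehat W,w)^2\le C_0\,\frac{\min\left(b^2\Omega_{\max},\,b^4\Omega_{\rm avg}\right)}{k}\left(\left(1+\log\frac1\delta\right)+\frac{E_{\max}C_{n,\delta}^2}{k}\right).$$
   Context: Setting (Bradley–Terry–Luce model): $G=(V,E)$ is an undirected connected graph with $V=\{1,\dots,n\}$, $n\ge 2$; each edge is given an arbitrary fixed orientation $(i,j)$. $B\in\mathbb{R}^{n\times|E|}$ is the incidence matrix: the column of edge $(i,j)$ has $+1$ in row $i$, $-1$ in row $j$, zeros elsewhere; $L=BB^T$ is the graph Laplacian and $L^\dagger$ its Moore–Penrose pseudoinverse. The unknown weight vector $w$ has positive entries and $b\ge \max_{i,j}w_i/w_j$. For each edge $(i,j)\in E$, $k$ comparisons are performed, each won by $i$ with probability $p_{ij}=w_i/(w_i+w_j)$, all comparisons (over all edges) independent. $F_{ij}$ is the fraction of the $k$ comparisons on edge $(i,j)$ won by $i$, and $R_{ij}=F_{ij}/F_{ji}$ (with $F_{ji}=1-F_{ij}$). Stacking the $R_{ij}$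 into $R\in\mathbb{R}^{|E|}$ (in the edge orientation order), the estimator is defined by $\log\widehat W=L^\dagger B\log R$ (logarithm and exponential entrywise), i.e. $\widehat W$ is a least-squares solution of $\log\widehat W_i-\log\widehat W_j=\log R_{ij}$, $(i,j)\in E$; if some $R_{ij}\in\{0,\infty\}$, $\widehat W$ is defined arbitrarily. $\sin(x,y)$ is the sine of the angle between nonzero vectors $x,y$. The effective resistance is $\Omega_{ij}=(e_i-e_j)^TL^\dagger(e_i-e_j)$ (resistance between $i$ and $j$ when each edge is a unit resistor), $\Omega_{\max}=\max_{i,j}\Omega_{ij}$, and $\Omega_{\rm avg}$ is the average of $\Omega_{ij}$ over all unordered pairs $\{i,j\}$ with $i\neq j$. $E_{ij}$ is the set of edges lying on at least one simple path from $i$ to $j$, and $E_{\max}=\max_{i,j}|E_{ij}|$. $C_{n,\delta}$ is a user-chosen parameter. *)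

(* Defs.v *)
From HB Require Import structures.
From mathcomp Require Import all_boot all_order all_algebra.
From mathcomp Require Import boolp reals sequences exp Rstruct.
Set Implicit Arguments. Unset Strict Implicit. Unset Printing Implicit Defensive.
Import Order.TTheory GRing.Theory Num.Theory.
Local Open Scope ring_scope.

Section BTL.
Context {R : realType}.

(* Graph on vertices 'I_n with m edges; edge e oriented (src e, dst e). *)
Definition adj (n m : nat) (src dst : 'I_m -> 'I_n) : rel 'I_n :=
  fun u v => [exists e, ((src e == u) && (dst e == v)) || ((src e == v) && (dst e == u))].

Definition simple_graph (n m : nat) (src dst : 'I_m -> 'I_n) : Prop :=
  (forall e, src e != dst e) /\
  (forall e e', ((src e == src e') && (dst e == dst e')) ||
                ((src e == dst e') && (dst e == src e')) -> e = e').

Definition connected_graph (n m : nat) (src dst : 'I_m -> 'I_n) : Prop :=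
  forall i j, connect (adj src dst) i j.

Definition incidence (n m : nat) (src dst : 'I_m -> 'I_n) : 'M[R]_(n, m) :=
  \matrix_(i, e) ((i == src e)%:R - (i == dst e)%:R).

Definition laplacian (n m : nat) (src dst : 'I_m -> 'I_n) : 'M[R]_n :=
  incidence src dst *m (incidence src dst)^T.

(* X is the Moore-Penrose pseudoinverse of A (Penrose conditions; it exists
   and is unique). *)
Definition is_MP_pinv (n : nat) (A X : 'M[R]_n) : Prop :=
  [/\ A *m X *m A = A, X *m A *m X = X,
      (A *m X)^T = A *m X & (X *m A)^T = X *m A].

Definition eff_res (n : nat) (Ldag : 'M[R]_n) (i j : 'I_n) : R :=
  let d : 'cV[R]_n := delta_mx i 0 - delta_mx j 0 in (d^T *m Ldag *m d) 0 0.

Definition Omega_max (n : nat) (Ldag : 'M[R]_n) : R :=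
  \big[Num.max/0]_(i : 'I_n) \big[Num.max/0]_(j : 'I_n) eff_res Ldag i j.

Definition Omega_avg (n : nat) (Ldag : 'M[R]_n) : R :=
  (\sum_(i : 'I_n) \sum_(j : 'I_n | (i < j)%N) eff_res Ldag i j) / ('C(n, 2))%:R.

(* E_ij: edges lying on at least one simple path from i to j.  A simple path
   is i :: s with consecutive vertices adjacent, all vertices distinct, ending
   at j; edge e lies on it iff its endpoints are consecutive on it. *)
Definition edge_on (n m : nat) (src dst : 'I_m -> 'I_n) (e : 'I_m)
  (i : 'I_n) (s : seq 'I_n) : bool :=
  has (fun uv : 'I_n * 'I_n => ((uv.1 == src e) && (uv.2 == dst e)) ||
                               ((uv.1 == dst e) && (uv.2 == src e)))
      (zip (i :: s) s).

Definition Eset (n m : nat) (src dst : 'I_m -> 'I_n) (i j : 'I_n) : {set 'I_m} :=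
  [set e : 'I_m | `[< exists s : seq 'I_n,
      [&& path (adj src dst) i s, uniq (i :: s), last i s == j &
          edge_on src dst e i s] >]].

Definition E_max (n m : nat) (src dst : 'I_m -> 'I_n) : nat :=
  \max_(i : 'I_n) \max_(j : 'I_n) #|Eset src dst i j|.

Definition dotv (n : nat) (x y : 'cV[R]_n) : R := (x^T *m y) 0 0.

Definition sin_angle (n : nat) (x y : 'cV[R]_n) : R :=
  Num.sqrt (1 - (dotv x y) ^+ 2 / (dotv x x * dotv y y)).

(* Probability model: outcome omega e t = true iff the t-th comparison on
   edge e = (src e, dst e) is won by src e.  All comparisons independent,
   each won by src e with probability p_e = w_src / (w_src + w_dst). *)
Definition outcome (m k : nat) := {ffun 'I_m -> {ffun 'I_k -> bool}}.

Definition pwin (n m : nat) (src dst : 'I_m -> 'I_n) (w : 'cV[R]_n) (e : 'I_m) : R :=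
  w (src e) 0 / (w (src e) 0 + w (dst e) 0).

Definition prob_outcome (n m k : nat) (src dst : 'I_m -> 'I_n) (w : 'cV[R]_n)
  (om : outcome m k) : R :=
  \prod_(e : 'I_m) \prod_(t : 'I_k)
    (if om e t then pwin src dst w e else 1 - pwin src dst w e).

Definition Prob (n m k : nat) (src dst : 'I_m -> 'I_n) (w : 'cV[R]_n)
  (P : pred (outcome m k)) : R :=
  \sum_(om : outcome m k | P om) prob_outcome src dst w om.

Definition frac (m k : nat) (om : outcome m k) (e : 'I_m) : R :=
  (\sum_(t : 'I_k) (om e t : nat))%:R / k%:R.

Definition logR (m k : nat) (om : outcome m k) : 'cV[R]_m :=
  \col_e ln (frac om e / (1 - frac om e)).

(* estimator: log What = L^+ B log R, when all R_e are in (0,oo);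
   otherwise What is the arbitrary value arb om. *)
Definition estimator (n m k : nat) (src dst : 'I_m -> 'I_n) (Ldag : 'M[R]_n)
  (arb : outcome m k -> 'cV[R]_n) (om : outcome m k) : 'cV[R]_n :=
  if [forall e, (0 < frac om e) && (frac om e < 1)]
  then \col_i expR ((Ldag *m incidence src dst *m logR om) i 0)
  else arb om.

End BTL.

(* Main.v *)
(* If [f^ij] is the unit electrical flow from [i] to [j] (potential
   [L^+ (e_i - e_j)]), then the error of [log What_i - log What_j] is
   [sum_e f^ij_e eps_e], where [eps_e] is the error of the empirical log-odds
   on [e].  Taylor expansion gives [eps_e = X_e / v_e + eta_e], with [X_e] the
   centred win frequency, [v_e = p_e (1 - p_e) >= 1 / (4 b)] and, by a Chernoff
   bound on all edges, [|eta_e| <= 128 b l / k] for [l = log (n / delta)].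
   - [f^ij] has energy [Omega_ij], is at most [1] on each edge and lives on
     [E_ij], so Cauchy-Schwarz bounds the contribution of [eta] by
     [sqrt (E_max Omega_ij)] times its maximum, and
     [1 <= Omega_max E_max], [Omega_max <= E_max]; multiplying the two
     assumptions on [k] then dominates every quantity of order [b l],
     [Omega_max b l].
   - A Bernstein bound over all pairs makes all pairwise errors at most [2],
     which linearizes the sine: it is controlled by a weighted sum of squared
     pairwise errors.
   - That sum is a quadratic form in subgaussian variables; the power mean
     inequality and a Markov bound on its moment of order [p ~ log (1 / delta)]
     control it without a union bound.
   The two terms of the minimum come from two choices of weights:
   [w_i^2 w_j^2 / |w|^4] and [4 b^2 / n^2]. *)
Require Import Defs.
From HB Require Import structures.
From mathcomp Require Import all_boot all_order all_algebra.
From mathcomp Require Import boolp reals sequences exp.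
From mathcomp Require Import ring lra.
Import Order.TTheory GRing.Theory Num.Theory.
Local Open Scope ring_scope.

(** * Elementary inequalities for the exponential, the logarithm and powers *)

Lemma expR_le_quad (R : realType) (x : R) :
  `|x| <= 3^-1 -> expR x <= 1 + x + x ^+ 2.
Proof.
rewrite ler_norml => /andP[h1 h2].
have h : 1 - x / 2 <= expR (- x / 2).
  by have := expR_ge1Dx (- x / 2); rewrite mulNr.
have h3 : (1 - x / 2) ^+ 2 <= expR (- x).
  have -> : - x = - x / 2 + - x / 2 by field.
  rewrite expRD -expr2; apply: lerXn2r => //; rewrite nnegrE ?expR_ge0 //; lra.
have h4 : 1 <= (1 + x + x ^+ 2) * expR (- x).
  (* The product equals [1 + x^2 (1 - 3 x + x^2) / 4]; the range [x <= 1/3] keeps [1 - 3 x]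
     nonnegative. *)
  apply: (@le_trans _ _ ((1 + x + x ^+ 2) * (1 - x / 2) ^+ 2)); first by nra.
  by apply: ler_wpM2l => //; nra.
by rewrite expRN ler_pdivlMr ?expR_gt0 // mul1r in h4.
Qed.

(** The linear term averages out for a centred variable, so this yields a subgaussian moment
    generating function with no restriction on [x]. For [|x| > 1/3] the term [3 x^2] dominates
    [|x|]. *)
Lemma expR_le_subgauss (R : realType) (x : R) :
  expR x <= x + expR (3 * x ^+ 2).
Proof.
have hq := expR_ge1Dx (3 * x ^+ 2).
case: (lerP `|x| 3^-1) => [/expR_le_quad|]; first by nra.
rewrite lter_normr => /orP[hx|hx].
  apply: (@le_trans _ _ (expR (3 * x ^+ 2))); last by lra.
  by rewrite ler_expR; nra.
apply: (@le_trans _ _ 1); last by nra.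
by rewrite -expR0 ler_expR; lra.
Qed.

(** Both sides come from [ln t <= t - 1], at [t = 1 + z] and at [t = 1 / (1 + z)]. *)
Lemma ln1D_quad (R : realType) (z : R) :
  `|z| <= 2^-1 -> `|ln (1 + z) - z| <= 2 * z ^+ 2.
Proof.
rewrite ler_norml => /andP[h1 h2].
have h0 : 0 < 1 + z by lra.
have hu : ln (1 + z) <= z.
  by rewrite -[leRHS]expRK ler_ln ?posrE ?expR_gt0 // expR_ge1Dx.
have hl : - ln (1 + z) <= (1 + z)^-1 - 1.
  rewrite -lnV ?posrE // -[leRHS]expRK ler_ln ?posrE ?expR_gt0 ?invr_gt0 //.
  by rewrite -[leLHS](subrKC 1) expR_ge1Dx.
have hv : (1 + z)^-1 - 1 <= - z + 2 * z ^+ 2.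
  rewrite lerBlDr -[leLHS]mul1r ler_pdivrMr //; nra.
by rewrite ler_norml; nra.
Qed.

(** The [n]-th power of [y / n <= expR (y / n)]; it converts exponential moments into polynomial
    ones. *)
Lemma exprn_le_expR (R : realType) (y : R) (n : nat) :
  0 <= y -> y ^+ n <= n%:R ^+ n * expR y.
Proof.
case: n => [|n] hy; first by rewrite !expr0 mul1r -expR0 ler_expR.
have n0 : 0 < n.+1%:R :> R by rewrite ltr0n.
have h : y / n.+1%:R <= expR (y / n.+1%:R).
  by apply: le_trans (expR_ge1Dx _); rewrite lerDr.
have -> : expR y = expR (y / n.+1%:R) ^+ n.+1.
  by rewrite -expRM_natl mulrC divfK ?gt_eqF.
rewrite -exprMn; apply: lerXn2r; rewrite ?nnegrE ?mulr_ge0 ?expR_ge0 //.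
by rewrite -ler_pdivrMl // mulrC.
Qed.

(** Convexity of the power, without derivatives: multiplying the tangent at one degree by [x]
    exceeds the tangent at the next degree by a multiple of [(x - c)^2]. *)
Lemma expr_tangent (R : realType) (x c : R) (n : nat) : 0 <= x -> 0 <= c ->
  c ^+ n.+1 + n.+1%:R * c ^+ n * (x - c) <= x ^+ n.+1.
Proof.
move=> hx hc; elim: n => [|n IH]; first by rewrite !expr1 expr0; lra.
rewrite exprS.
apply: le_trans (ler_wpM2l hx IH).
rewrite -subr_ge0 [X in 0 <= X](_ : _ = n.+1%:R * c ^+ n * (x - c) ^+ 2).
  by rewrite mulr_ge0 ?sqr_ge0 // mulr_ge0 ?exprn_ge0.
rewrite -[n.+2]addn1 natrD !exprS; ring.
Qed.

(** Jensen's inequality: average the tangent inequality at the weighted mean [c], where the linear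
    terms cancel. *)
Lemma power_mean (R : realType) (I : finType) (P : pred I) (q y : I -> R) (n : nat) :
  (forall i, 0 <= q i) -> (forall i, 0 <= y i) -> \sum_(i | P i) q i = 1 ->
  (\sum_(i | P i) q i * y i) ^+ n.+1 <= \sum_(i | P i) q i * y i ^+ n.+1.
Proof.
move=> hq hy hs; set c := \sum_(i | P i) q i * y i.
have hc : 0 <= c by apply: sumr_ge0 => i _; exact: mulr_ge0.
apply: (@le_trans _ _
    (\sum_(i | P i) q i * (c ^+ n.+1 + n.+1%:R * c ^+ n * (y i - c)))); last first.
  by apply: ler_sum => i _; apply: ler_wpM2l => //; exact: expr_tangent.
rewrite (eq_bigr (fun i => q i * (c ^+ n.+1 - n.+1%:R * c ^+ n * c)
   + n.+1%:R * c ^+ n * (q i * y i))); last by move=> i _; ring.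
rewrite big_split /= -mulr_suml -mulr_sumr hs -/c; lra.
Qed.

(** By convexity the difference is at most [(a - b) * expR a] when [b <= a], and [a <= c + 2]. The
    free reference point [c] is what lets the norm of the estimator be recovered by summation. *)
Lemma expR_sub_sqr (R : realType) (a b c : R) : `|a - c| <= 2 -> `|b - c| <= 2 ->
  (expR a - expR b) ^+ 2 <= (a - b) ^+ 2 * (expR 4 * expR c ^+ 2).
Proof.
wlog ab : a b / b <= a => [H|].
  case: (leP b a) => [|/ltW] ab ha hb; first exact: H.
  by rewrite -sqrrN opprB -[X in _ <= X * _]sqrrN opprB; exact: H.
move=> ha _.
have h1 : 0 <= expR a - expR b by rewrite subr_ge0 ler_expR.
have h2 : expR a - expR b <= (a - b) * expR a.
  have := expR_ge1Dx (b - a); have ea := expR_gt0 a.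
  have -> : expR b = expR (b - a) * expR a by rewrite -expRD subrK.
  move: (expR (b - a)) => t; nra.
have h3 : expR a ^+ 2 <= expR 4 * expR c ^+ 2.
  rewrite -!expRM_natl -expRD ler_expR; move: ha; rewrite ler_norml; lra.
apply: (@le_trans _ _ (((a - b) * expR a) ^+ 2)).
  by apply: lerXn2r => //; rewrite nnegrE // (le_trans h1).
by rewrite exprMn; apply: ler_wpM2l => //; exact: sqr_ge0.
Qed.

(** * The sine of an angle as a weighted sum of squared pairwise differences *)

Lemma dotvE (R : realType) (n : nat) (x y : 'cV[R]_n) :
  dotv x y = \sum_i x i 0 * y i 0.
Proof. by rewrite /dotv mxE; apply: eq_bigr => i _; rewrite mxE. Qed.

Lemma lagrange_identity (R : realType) (I : finType) (x y : I -> R) :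
  \sum_i \sum_j (x i * y j - x j * y i) ^+ 2 =
  2 * ((\sum_i x i ^+ 2) * (\sum_i y i ^+ 2) - (\sum_i x i * y i) ^+ 2).
Proof.
have E (f g : I -> R) : \sum_i \sum_j f i * g j = (\sum_i f i) * (\sum_j g j).
  by rewrite mulr_suml; apply: eq_bigr => i _; rewrite mulr_sumr.
transitivity (\sum_i \sum_j (x i ^+ 2 * y j ^+ 2 + y i ^+ 2 * x j ^+ 2
   - 2 * (x i * y i) * (x j * y j))).
  by apply: eq_bigr => i _; apply: eq_bigr => j _; ring.
under eq_bigr => i _ do rewrite sumrB big_split /=.
rewrite sumrB big_split /= !E -mulr_sumr; ring.
Qed.

(** Lagrange's identity writes the squared sine through the minors [x_i y_j - x_j y_i], and each
    minor equals [y_i y_j (expR (a i) - expR (a j))]. *)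
Lemma sin_angle_le (R : realType) (n : nat) (x y : 'cV[R]_n) (a : 'I_n -> R) : (0 < n)%N ->
  (forall i, 0 < y i 0) -> (forall i, x i 0 = y i 0 * expR (a i)) ->
  (forall i j, `|a i - a j| <= 2) ->
  sin_angle x y ^+ 2 <= expR 4 / 2 * \sum_i \sum_j
    (y i 0 ^+ 2 / dotv y y) * (y j 0 ^+ 2 / dotv y y) * (a i - a j) ^+ 2.
Proof.
move=> n0 hy hx ha.
have sum_gt0 (z : 'I_n -> R) : (forall i, 0 < z i) -> 0 < \sum_i z i ^+ 2.
  move=> hz; rewrite (bigD1 (Ordinal n0)) //= ltr_wpDr ?exprn_gt0 //.
  by apply: sumr_ge0 => i _; exact: sqr_ge0.
have yyE : dotv y y = \sum_i y i 0 ^+ 2 by rewrite dotvE.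
have xxE : dotv x x = \sum_i x i 0 ^+ 2 by rewrite dotvE.
have hyy : 0 < dotv y y by rewrite yyE; exact: sum_gt0.
have hxx : 0 < dotv x x.
  by rewrite xxE; apply: sum_gt0 => i; rewrite hx mulr_gt0 ?expR_gt0.
have hS : 0 <= expR 4 / 2 * \sum_i \sum_j
    (y i 0 ^+ 2 / dotv y y) * (y j 0 ^+ 2 / dotv y y) * (a i - a j) ^+ 2.
  apply: mulr_ge0; first by rewrite divr_ge0 ?expR_ge0.
  apply: sumr_ge0 => i _; apply: sumr_ge0 => j _.
  by rewrite mulr_ge0 ?sqr_ge0 // mulr_ge0 // divr_ge0 ?sqr_ge0 // ltW.
(* [Num.sqrt] is [0] on negative arguments, so that case only needs [hS]. *)
rewrite /sin_angle; case: (leP 0 (1 - dotv x y ^+ 2 / (dotv x x * dotv y y))) => h0;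
  last by rewrite ler0_sqrtr ?expr0n // ltW.
rewrite sqr_sqrtr //.
have -> : 1 - dotv x y ^+ 2 / (dotv x x * dotv y y) =
    2^-1 * (\sum_i \sum_j (x i 0 * y j 0 - x j 0 * y i 0) ^+ 2)
      / (dotv x x * dotv y y).
  rewrite lagrange_identity -xxE -yyE -dotvE; field.
  by rewrite !gt_eqF.
rewrite [X in X / _]mulr_sumr mulr_suml [leRHS]mulr_sumr; apply: ler_sum => i _.
rewrite [X in X / _]mulr_sumr mulr_suml [leRHS]mulr_sumr; apply: ler_sum => j _.
(* Each summand [l] of [dotv y y] is handled with reference point [a l]; the factors
   [y l 0 ^+ 2 * expR (a l) ^+ 2] then add up to [dotv x x]. *)
have key : dotv y y * (x i 0 * y j 0 - x j 0 * y i 0) ^+ 2 <=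
    expR 4 * dotv x x * (y i 0 ^+ 2 * y j 0 ^+ 2 * (a i - a j) ^+ 2).
  rewrite {1}yyE xxE mulr_suml mulr_sumr mulr_suml; apply: ler_sum => l _.
  rewrite !hx.
  rewrite [leLHS](_ : _ = y l 0 ^+ 2 * (y i 0 ^+ 2 * y j 0 ^+ 2) *
    (expR (a i) - expR (a j)) ^+ 2); last by ring.
  rewrite [leRHS](_ : _ = y l 0 ^+ 2 * (y i 0 ^+ 2 * y j 0 ^+ 2) *
    ((a i - a j) ^+ 2 * (expR 4 * expR (a l) ^+ 2))); last by ring.
  apply: ler_wpM2l; first by rewrite mulr_ge0 ?sqr_ge0 // mulr_ge0 ?sqr_ge0.
  exact: expR_sub_sqr.
rewrite ler_pdivrMr ?mulr_gt0 //.
rewrite [leRHS](_ : _ = 2^-1 * (expR 4 * dotv x x *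
   (y i 0 ^+ 2 * y j 0 ^+ 2 * (a i - a j) ^+ 2)) / dotv y y); last first.
  by field; rewrite gt_eqF.
rewrite ler_pdivlMr // -[leLHS]mulrA ler_wpM2l ?invr_ge0 //.
by rewrite [leLHS]mulrC.
Qed.

(* Averaging the triangle inequality through [l] over all [l] makes only one
   of the two weights leave the sum. *)
Lemma weighted_dispersion (R : realType) (n : nat) (q a : 'I_n -> R) (B : R) : (0 < n)%N ->
  (forall i, 0 <= q i) -> \sum_i q i = 1 -> (forall i, q i <= B / n%:R) ->
  \sum_i \sum_j q i * q j * (a i - a j) ^+ 2 <=
  \sum_i \sum_j 4 * B / n%:R ^+ 2 * (a i - a j) ^+ 2.
Proof.
move=> n_gt0 q0 q1 qB.
have n0 : 0 < n%:R :> R by rewrite ltr0n.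
set T := \sum_i \sum_l q i * (a i - a l) ^+ 2.
have h1 : n%:R * (\sum_i \sum_j q i * q j * (a i - a j) ^+ 2) <= 4 * T.
  apply: (@le_trans _ _ (\sum_i \sum_j \sum_(l < n)
      (2 * (q j * (q i * (a i - a l) ^+ 2)) + 2 * (q i * (q j * (a j - a l) ^+ 2))))).
    rewrite mulr_sumr; apply: ler_sum => i _.
    rewrite mulr_sumr; apply: ler_sum => j _.
    rewrite mulr_natl -[X in _ *+ X](card_ord n) -sumr_const.
    apply: ler_sum => l _.
    have qq : 0 <= q i * q j by exact: mulr_ge0.
    have : (a i - a j) ^+ 2 <= 2 * (a i - a l) ^+ 2 + 2 * (a j - a l) ^+ 2.
      have := sqr_ge0 (a i + a j - 2 * a l); nra.
    by move/(ler_wpM2l qq); lra.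
  rewrite le_eqVlt; apply/orP; left; apply/eqP.
  under eq_bigr => i _ do under eq_bigr => j _ do
    rewrite big_split /= -!mulr_sumr.
  under eq_bigr => i _ do rewrite big_split /= -!mulr_sumr -mulr_suml q1 mul1r.
  rewrite big_split /= -!mulr_sumr -mulr_suml q1 mul1r.
  have -> : \sum_i q i * \sum_(l < n) (a i - a l) ^+ 2 = T.
    by apply: eq_bigr => i _; rewrite mulr_sumr.
  ring.
have h2 : T <= \sum_i \sum_j B / n%:R * (a i - a j) ^+ 2.
  apply: ler_sum => i _; apply: ler_sum => j _.
  by apply: ler_wpM2r => //; exact: sqr_ge0.
rewrite -(ler_pM2l (n0)); apply: le_trans h1 _.
apply: (@le_trans _ _ (4 * (\sum_i \sum_j B / n%:R * (a i - a j) ^+ 2))).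
  by apply: ler_wpM2l.
rewrite !mulr_sumr; apply: ler_sum => i _; rewrite !mulr_sumr.
apply: ler_sum => j _; rewrite le_eqVlt; apply/orP; left; apply/eqP.
by field; rewrite gt_eqF.
Qed.

(** * Expectations and tail bounds *)

Section Expectation.
Context {R : realType} {n m k : nat} (src dst : 'I_m -> 'I_n) (w : 'cV[R]_n).

Definition expect (g : outcome m k -> R) : R :=
  \sum_om prob_outcome src dst w om * g om.

(** Independence: sum and product are exchanged twice, over the edges and then over the comparisons
    on one edge. *)
Lemma expect_prod (h : 'I_m -> bool -> R) :
  expect (fun om => \prod_e \prod_(t < k) h e (om e t)) =
  \prod_e (pwin src dst w e * h e true + (1 - pwin src dst w e) * h e false) ^+ k.
Proof.
pose F e (c : bool) := (if c then pwin src dst w e else 1 - pwin src dst w e) * h e c.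
transitivity (\sum_(om : outcome m k) \prod_e \prod_(t < k) F e (om e t)).
  apply: eq_bigr => om _; rewrite /prob_outcome -big_split /=.
  by apply: eq_bigr => e _; rewrite -big_split.
rewrite -(bigA_distr_bigA (fun e (f : {ffun 'I_k -> bool}) => \prod_(t < k) F e (f t))).
apply: eq_bigr => e _.
rewrite -(bigA_distr_bigA (fun (t : 'I_k) c => F e c)).
rewrite prodr_const card_ord; congr (_ ^+ _).
by rewrite big_bool.
Qed.

Hypothesis w_gt0 : forall i, 0 < w i 0.

Lemma pwin_gt0 e : 0 < pwin src dst w e.
Proof. by rewrite divr_gt0 ?addr_gt0. Qed.

Lemma pwin_lt1 e : pwin src dst w e < 1.
Proof. by rewrite ltr_pdivrMr ?addr_gt0 // mul1r ltrDl. Qed.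

Lemma prob_outcome_ge0 om : 0 <= prob_outcome (k := k) src dst w om.
Proof.
apply: prodr_ge0 => e _; apply: prodr_ge0 => t _; have := pwin_gt0 e.
by have := pwin_lt1 e; case: ifP; lra.
Qed.

Lemma expect_le g h : (forall om, g om <= h om) -> expect g <= expect h.
Proof.
by move=> gh; apply: ler_sum => om _; rewrite ler_wpM2l ?prob_outcome_ge0.
Qed.

Lemma expectZ c g : expect (fun om => c * g om) = c * expect g.
Proof. by rewrite mulr_sumr; apply: eq_bigr => om _; rewrite mulrCA. Qed.

Lemma expectD g h : expect (fun om => g om + h om) = expect g + expect h.
Proof. by rewrite -big_split; apply: eq_bigr => om _; rewrite mulrDr. Qed.

Lemma expect_sum (I : finType) (P : pred I) (g : I -> outcome m k -> R) :
  expect (fun om => \sum_(i | P i) g i om) = \sum_(i | P i) expect (g i).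
Proof. by rewrite exchange_big; apply: eq_bigr => om _; rewrite mulr_sumr. Qed.

Lemma expect1 : expect (fun=> 1) = 1.
Proof.
have := expect_prod (fun _ _ => 1); rewrite [in RHS]big1 => [h|e _].
  rewrite -[RHS]h; congr expect.
  by apply/boolp.funext => om; rewrite big1 // => e _; rewrite big1.
by rewrite !mulr1 addrC subrK expr1n.
Qed.

Lemma Prob_expect (P : pred (outcome m k)) :
  Prob src dst w P = expect (fun om => (P om)%:R).
Proof.
by rewrite /Prob big_mkcond; apply: eq_bigr => om _; rewrite mulr_natr mulrb.
Qed.

Lemma Prob_markov (P : pred (outcome m k)) g :
  (forall om, 0 <= g om) -> (forall om, P om -> 1 <= g om) ->
  Prob src dst w P <= expect g.
Proof.
move=> g0 g1; rewrite Prob_expect; apply: expect_le => om.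
by case: (boolP (P om)) => [/g1|].
Qed.

Lemma Prob_union (I : finType) (P : I -> pred (outcome m k)) c :
  (forall i, Prob src dst w (P i) <= c) ->
  Prob src dst w (fun om => [exists i, P i om]) <= #|I|%:R * c.
Proof.
move=> hc; apply: (@le_trans _ _ (\sum_i Prob src dst w (P i))); last first.
  by rewrite mulr_natl -sumr_const; apply: ler_sum.
rewrite (eq_bigr _ (fun i _ => Prob_expect (P i))) -expect_sum.
apply: Prob_markov => [om|om /existsP[i Pi]]; first exact: sumr_ge0.
by rewrite (bigD1 i) //= Pi lerDl sumr_ge0.
Qed.

Lemma Prob_good (A B C D : pred (outcome m k)) (d : R) :
  Prob src dst w A <= d / 3 -> Prob src dst w B <= d / 3 ->
  Prob src dst w C <= d / 3 ->
  (forall om, ~~ A om -> ~~ B om -> ~~ C om -> D om) ->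
  1 - d <= Prob src dst w D.
Proof.
move=> hA hB hC hD.
suff : 1 <= Prob src dst w A + Prob src dst w B + Prob src dst w C + Prob src dst w D.
  lra.
rewrite !Prob_expect -!expectD -[leLHS]expect1; apply: expect_le => om.
rewrite -!natrD ler1n; move: (hD om).
by case: (A om); case: (B om); case: (C om); case: (D om) => // /(_ isT isT isT).
Qed.

Definition noise (om : outcome m k) (e : 'I_m) : R := Defs.frac om e - pwin src dst w e.

(* The two values of a centred Bernoulli(p) variable are [1 - p] and [- p]. *)
Lemma mgf_noise (c : 'I_m -> R) (B : 'I_m -> R) : (0 < k)%N ->
  (forall e, pwin src dst w e * expR (c e / k%:R * (1 - pwin src dst w e))
     + (1 - pwin src dst w e) * expR (c e / k%:R * - pwin src dst w e)
     <= expR (B e / k%:R)) ->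
  expect (fun om => expR (\sum_e c e * noise om e)) <= expR (\sum_e B e).
Proof.
move=> k0 hB.
have kn0 : k%:R != 0 :> R by rewrite pnatr_eq0 -lt0n.
pose h e (x : bool) := expR (c e / k%:R * (x%:R - pwin src dst w e)).
have -> : (fun om => expR (\sum_e c e * noise om e)) =
    (fun om : outcome m k => \prod_e \prod_(t < k) h e (om e t)).
  apply/boolp.funext => om; rewrite expR_sum; apply: eq_bigr => e _.
  rewrite -expR_sum -mulr_sumr sumrB sumr_const card_ord /noise /Defs.frac natr_sum.
  by congr expR; rewrite -[_ *+ k]mulr_natr; field.
have step e : 0 <= pwin src dst w e * h e true + (1 - pwin src dst w e) * h e false.
  have := pwin_gt0 e; have := pwin_lt1 e => ? ?.
  by rewrite addr_ge0 // mulr_ge0 ?expR_ge0 //; lra.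
rewrite expect_prod expR_sum; apply: ler_prod => e _.
rewrite exprn_ge0 //= (_ : B e = k%:R * (B e / k%:R)); last by rewrite mulrC divfK.
rewrite expRM_natl; apply: lerXn2r; rewrite ?nnegrE ?expR_ge0 //.
by apply: le_trans (hB e); rewrite /h sub0r.
Qed.

Definition pvar e : R := pwin src dst w e * (1 - pwin src dst w e).

(** Keeping the variance: the linear terms of the quadratic bound cancel, and the quadratic ones add
    up by [p (1 - p)^2 + (1 - p) p^2 = p (1 - p)]. *)
Lemma mgf_bernstein (c : 'I_m -> R) : (0 < k)%N ->
  (forall e, `|c e| <= 3^-1 * k%:R) ->
  expect (fun om => expR (\sum_e c e * noise om e)) <=
  expR (\sum_e pvar e * c e ^+ 2 / k%:R).
Proof.
move=> k0 hc; apply: mgf_noise => // e.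
have kp : 0 < k%:R :> R by rewrite ltr0n.
have := pwin_gt0 e; have := pwin_lt1 e; rewrite /pvar.
set p := pwin _ _ _ _ => p1 p0.
have : `|c e / k%:R| <= 3^-1.
  by rewrite normrM normfV (gtr0_norm kp) ler_pdivrMr.
rewrite [X in _ <= expR X](_ : _ = p * (1 - p) * (c e / k%:R) ^+ 2); last first.
  by field; rewrite gt_eqF.
move: (c e / k%:R) => s hs.
have b1 : `|s * (1 - p)| <= 3^-1.
  by rewrite normrM (@ger0_norm _ (1 - p)); have := normr_ge0 s; nra.
have b2 : `|s * - p| <= 3^-1.
  by rewrite normrM normrN (@ger0_norm _ p); have := normr_ge0 s; nra.
have := expR_le_quad _ _ b1; have := expR_le_quad _ _ b2.
have := expR_ge1Dx (p * (1 - p) * s ^+ 2).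
have : 0 <= s ^+ 2 by exact: sqr_ge0.
move: (expR _) (expR _) (expR _) => x y z; nra.
Qed.

(** Here the coefficients may be arbitrarily large, at the price of replacing the variance by a
    constant. High moments need this freedom. *)
Lemma mgf_subgauss (c : 'I_m -> R) : (0 < k)%N ->
  expect (fun om => expR (\sum_e c e * noise om e)) <=
  expR (\sum_e 3 * c e ^+ 2 / k%:R).
Proof.
move=> k0; apply: mgf_noise => // e.
have kp : 0 < k%:R :> R by rewrite ltr0n.
have := pwin_gt0 e; have := pwin_lt1 e.
set p := pwin _ _ _ _ => p1 p0.
rewrite [X in _ <= expR X](_ : _ = 3 * (c e / k%:R) ^+ 2); last first.
  by field; rewrite gt_eqF.
move: (c e / k%:R) => s.
have s2 := sqr_ge0 s.
have h1 : expR (3 * (s * (1 - p)) ^+ 2) <= expR (3 * s ^+ 2).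
  by rewrite ler_expR exprMn ler_wpM2l // ler_piMr //; nra.
have h2 : expR (3 * (s * - p) ^+ 2) <= expR (3 * s ^+ 2).
  by rewrite ler_expR exprMn ler_wpM2l // ler_piMr //; nra.
have h3 := le_trans (expR_le_subgauss _ (s * (1 - p))) (lerD (lexx _) h1).
have h4 := le_trans (expR_le_subgauss _ (s * - p)) (lerD (lexx _) h2).
have q0 : 0 <= 1 - p by lra.
have := lerD (ler_wpM2l (ltW p0) h3) (ler_wpM2l q0 h4); lra.
Qed.

End Expectation.

Section Tails.
Context {R : realType} {n m k : nat} (src dst : 'I_m -> 'I_n) (w : 'cV[R]_n).
Hypothesis w_gt0 : forall i, 0 < w i 0.
Hypothesis k_gt0 : (0 < k)%N.

Let X (om : outcome m k) e := noise src dst w om e.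
Let E := @expect R n m k src dst w.

(** Exponential Markov inequality for both signs. The usual tilting parameter is absorbed into [c],
    so each application chooses the scale of [c] together with [t]. *)
Lemma bernstein_tail (c : 'I_m -> R) (t : R) :
  (forall e, `|c e| <= 3^-1 * k%:R) ->
  Prob src dst w (fun om => t <= `|\sum_e c e * X om e|) <=
  2 * expR (\sum_e pvar src dst w e * c e ^+ 2 / k%:R - t).
Proof.
move=> hc; pose c' e := - c e.
apply: (@le_trans _ _ (E (fun om => expR (- t) *
  (expR (\sum_e c e * X om e) + expR (\sum_e c' e * X om e))))).
  apply: Prob_markov => // om; first by rewrite mulr_ge0 ?addr_ge0 ?expR_ge0.
  rewrite mulrDr -!expRD lter_normr => /orP[] ht.
    rewrite ler_wpDr ?expR_ge0 // -[leLHS]expR0 ler_expR; lra.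
  rewrite ler_wpDl ?expR_ge0 // -[leLHS]expR0 ler_expR.
  under eq_bigr => e _ do rewrite mulNr.
  rewrite sumrN; lra.
rewrite /E expectZ expectD expRD [leRHS]mulrA [leRHS]mulrC ler_wpM2l ?expR_ge0 //.
have h1 := mgf_bernstein _ _ _ w_gt0 _ k_gt0 hc.
rewrite mulr_natl mulr2n; apply: lerD; first exact: h1.
apply: le_trans (mgf_bernstein _ _ _ w_gt0 c' k_gt0 _) _.
  by move=> e; rewrite normrN.
by under eq_bigr => e _ do rewrite sqrrN.
Qed.

(** The power of order [2 p] is dominated by [expR |l Y|], hence by the sum of the exponentials of
    [l Y] and [- l Y]. *)
Lemma subgauss_moment (c : 'I_m -> R) (p : nat) : (0 < p)%N ->
  0 < \sum_e c e ^+ 2 ->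
  E (fun om => ((\sum_e c e * X om e) ^+ 2) ^+ p) <=
  2 * (12 * expR 1 * p%:R * (\sum_e c e ^+ 2) / k%:R) ^+ p.
Proof.
move=> p0; set V := \sum_e _ => V0.
have pR : 0 < p%:R :> R by rewrite ltr0n.
have kR : 0 < k%:R :> R by rewrite ltr0n.
(* This tilt makes the subgaussian exponent [3 * l2 * V / k] equal to [p]. *)
pose l2 : R := p%:R * k%:R / (3 * V).
have l20 : 0 < l2 by rewrite divr_gt0 ?mulr_gt0.
pose l := Num.sqrt l2.
have lE : l ^+ 2 = l2 by rewrite sqr_sqrtr // ltW.
pose A := ((2 * p)%:R ^+ 2 / l2) ^+ p.
pose c1 e := l * c e; pose c2 e := - l * c e.
have mgf c' : (forall e, c' e ^+ 2 = l2 * c e ^+ 2) ->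
    E (fun om => expR (\sum_e c' e * X om e)) <= expR 1 ^+ p.
  move=> hc'; apply: le_trans (mgf_subgauss _ _ _ w_gt0 c' k_gt0) _.
  rewrite -expRM_natl mulr1 ler_expR.
  have -> : \sum_e 3 * c' e ^+ 2 / k%:R = 3 * l2 / k%:R * V.
    rewrite mulr_sumr; apply: eq_bigr => e _; rewrite hc'; field.
    by rewrite gt_eqF.
  rewrite /l2 le_eqVlt; apply/orP; left; apply/eqP.
  by field; rewrite !gt_eqF.
have A0 : 0 <= A by rewrite exprn_ge0 // divr_ge0 ?sqr_ge0 // ltW.
apply: (@le_trans _ _ (E (fun om => A *
  (expR (\sum_e c1 e * X om e) + expR (\sum_e c2 e * X om e))))).
  apply: expect_le => // om; set Y := \sum_e c e * X om e.
  have -> : \sum_e c1 e * X om e = l * Y.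
    by rewrite mulr_sumr; apply: eq_bigr => e _; rewrite mulrA.
  have -> : \sum_e c2 e * X om e = - (l * Y).
    by rewrite -mulNr mulr_sumr; apply: eq_bigr => e _; rewrite mulrA.
  have h := exprn_le_expR _ _ (2 * p) (normr_ge0 (l * Y)).
  have h2 : expR `|l * Y| <= expR (l * Y) + expR (- (l * Y)).
    by case: (ger0P (l * Y)) => _; rewrite ?lerDl ?lerDr expR_ge0.
  have h3 := le_trans h (ler_wpM2l (exprn_ge0 (2 * p) (ler0n R (2 * p))) h2).
  rewrite exprM -normrX ger0_norm ?sqr_ge0 // [(l * Y) ^+ 2]exprMn lE exprMn in h3.
  rewrite /A expr_div_n -[X in X / _]exprM mulrAC ler_pdivlMr ?exprn_gt0 //.
  by rewrite [leLHS]mulrC.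
rewrite /E expectZ expectD.
apply: (@le_trans _ _ (A * (expR 1 ^+ p + expR 1 ^+ p))).
  apply: ler_wpM2l => //; apply: lerD; apply: mgf => e.
    by rewrite exprMn lE.
  by rewrite exprMn sqrrN lE.
rewrite le_eqVlt; apply/orP; left; apply/eqP.
transitivity (2 * (A * expR 1 ^+ p)); first by ring.
rewrite -exprMn; congr (_ * _ ^+ p).
rewrite /l2 natrM; field.
by rewrite !gt_eqF.
Qed.

(** The power mean with weights [q i * s i / Q] reduces the [p]-th moment of the whole form to those
    of the normalized squares. The threshold is [expR 1] times the resulting scale, which produces
    [expR (- p)]. *)
Lemma quadratic_tail (I : finType) (P : pred I) (q : I -> R) (c : I -> 'I_m -> R)
    (p : nat) (Q := \sum_(i | P i) q i * \sum_e c i e ^+ 2) :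
  (0 < p)%N -> (forall i, 0 <= q i) -> 0 < Q ->
  (forall i, P i -> 0 < \sum_e c i e ^+ 2) ->
  Prob src dst w (fun om => 12 * expR 1 ^+ 2 * p%:R * Q / k%:R <
     \sum_(i | P i) q i * (\sum_e c i e * X om e) ^+ 2) <= 2 * expR (- p%:R).
Proof.
move=> p0 q0 Q0 c0.
have pR : 0 < p%:R :> R by rewrite ltr0n.
have kR : 0 < k%:R :> R by rewrite ltr0n.
have e0 : 0 < expR 1 :> R := expR_gt0 1.
pose s i := \sum_e c i e ^+ 2.
have s0 i : 0 <= s i by apply: sumr_ge0 => e _; exact: sqr_ge0.
pose Y i om := \sum_e c i e * X om e.
set u := 12 * _ * _ * _ / _.
have u0 : 0 < u by rewrite !mulr_gt0 ?invr_gt0 ?exprn_gt0.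
pose g om := (Q / u) ^+ p * \sum_(i | P i) (q i * s i / Q) * (Y i om ^+ 2 / s i) ^+ p.
have g0 om : 0 <= g om.
  apply: mulr_ge0; first by rewrite exprn_ge0 // divr_ge0 ?ltW.
  apply: sumr_ge0 => i _; rewrite mulr_ge0 ?exprn_ge0 ?divr_ge0 ?sqr_ge0 //.
    exact: mulr_ge0.
  exact: ltW.
apply: (@le_trans _ _ (E g)).
  apply: Prob_markov => // om hu.
  apply: (@le_trans _ _ ((Q / u) ^+ p *
     (\sum_(i | P i) (q i * s i / Q) * (Y i om ^+ 2 / s i)) ^+ p)); last first.
    apply: ler_wpM2l; first by rewrite exprn_ge0 // divr_ge0 ?ltW.
    case: p p0 {pR u u0 hu g g0} => // p _; apply: power_mean => [i|i|].
    - by rewrite divr_ge0 ?mulr_ge0 // ltW.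
    - by rewrite divr_ge0 ?sqr_ge0.
    - by rewrite -mulr_suml divff // gt_eqF.
  rewrite -exprMn; apply: exprn_ege1.
  rewrite mulrAC ler_pdivlMr // mul1r (le_trans (ltW hu)) // mulr_sumr.
  rewrite le_eqVlt; apply/orP; left; apply/eqP; apply: eq_bigr => i /c0 si.
  by rewrite -/(Y i om); field; rewrite !gt_eqF.
rewrite /E /g expectZ expect_sum.
apply: (@le_trans _ _ ((Q / u) ^+ p * (2 * (12 * expR 1 * p%:R / k%:R) ^+ p))).
  apply: ler_wpM2l; first by rewrite exprn_ge0 // divr_ge0 ?ltW.
  apply: (@le_trans _ _ (\sum_(i | P i) (q i * s i / Q) *
      (2 * (12 * expR 1 * p%:R / k%:R) ^+ p))); last first.
    by rewrite -mulr_suml -mulr_suml divff ?mul1r // gt_eqF.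
  apply: ler_sum => i /c0 si; rewrite expectZ.
  apply: ler_wpM2l; first by rewrite divr_ge0 ?mulr_ge0 // ltW.
  have -> : (fun om : outcome m k => (Y i om ^+ 2 / s i) ^+ p) =
      fun om => (s i)^-1 ^+ p * (Y i om ^+ 2) ^+ p.
    by apply/boolp.funext => om; rewrite exprMn mulrC.
  rewrite expectZ; apply: le_trans (ler_wpM2l _ (subgauss_moment _ _ p0 si)) _.
    by rewrite exprn_ge0 // invr_ge0.
  rewrite mulrCA ler_wpM2l // -exprMn le_eqVlt; apply/orP; left; apply/eqP.
  by congr (_ ^+ p); rewrite /s; field; rewrite !gt_eqF.
rewrite mulrCA ler_wpM2l // -exprMn -[p%:R]mulr1 -mulrN expRM_natl.
rewrite le_eqVlt; apply/orP; left; apply/eqP; congr (_ ^+ p).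
by rewrite expRN /u; field; rewrite !gt_eqF.
Qed.

End Tails.

Lemma cauchy_schwarz (R : realType) (I : finType) (x y : I -> R) :
  (\sum_i x i * y i) ^+ 2 <= (\sum_i x i ^+ 2) * (\sum_i y i ^+ 2).
Proof.
rewrite -subr_ge0 -(pmulr_rge0 _ (ltr0n R 2)) -lagrange_identity.
by apply: sumr_ge0 => i _; apply: sumr_ge0 => j _; exact: sqr_ge0.
Qed.

(** * Electrical flows *)

Section ElectricalFlow.
Context {R : realType} {n m : nat} (src dst : 'I_m -> 'I_n).
Implicit Types (phi g : 'I_n -> R) (i j : 'I_n) (e : 'I_m).

(* The weak form of Kirchhoff's law: the flow [phi (src e) - phi (dst e)] has
   net outflow [1] at [i], [-1] at [j] and [0] elsewhere. *)
Definition unit_flow phi i j := forall g,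
  \sum_e (phi (src e) - phi (dst e)) * (g (src e) - g (dst e)) = g i - g j.

Lemma unit_flowN phi i j : unit_flow phi i j -> unit_flow (fun x => - phi x) j i.
Proof.
move=> H g; rewrite -opprB -H -sumrN; apply: eq_bigr => e _ /=; ring.
Qed.

(* Kirchhoff's law summed over a superlevel set of the potential bounds the
   flow on every edge leaving the set, since no flow enters it. *)
Lemma unit_flow_le1 phi i j e : unit_flow phi i j ->
  `|phi (src e) - phi (dst e)| <= 1.
Proof.
move=> H; pose c := Num.max (phi (src e)) (phi (dst e)).
pose g x : R := (c <= phi x)%R%:R.
pose t e' := (phi (src e') - phi (dst e')) * (g (src e') - g (dst e')).
have t0 e' : 0 <= t e'.
  rewrite /t /g; case: (leP c (phi (src e'))); case: (leP c (phi (dst e'))) => /=; lra.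
have : t e <= g i - g j.
  by rewrite -H (bigD1 e) //= lerDl; apply: sumr_ge0 => e' _; exact: t0.
have -> : t e = `|phi (src e) - phi (dst e)|.
  rewrite /t /g /c; case: (ltgtP (phi (src e)) (phi (dst e))) => h.
  - rewrite lexx leNgt h /= ltr0_norm; lra.
  - rewrite lexx leNgt h /= gtr0_norm; lra.
  - by rewrite h subrr mul0r normr0.
by rewrite /g; case: (_ <= phi i); case: (_ <= phi j) => /=; lra.
Qed.

Definition downhill phi : rel 'I_n := fun u v => adj src dst u v && (phi v < phi u).

Lemma adj_sym u v : adj src dst u v = adj src dst v u.
Proof. by apply: eq_existsb => e; rewrite orbC. Qed.

(** Flow that enters [v] must leave it. If no neighbour of [v] were lower, testing Kirchhoff's law
    with the indicator of [v] would give a negative net outflow, which only the sink [j] allows. *)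
Lemma downhill_step phi i j u v : unit_flow phi i j -> downhill phi u v -> v != j ->
  exists x, downhill phi v x.
Proof.
move=> H /andP[/existsP[e0 he0] uv] vj; apply: contrapT => hN.
have low e : (src e == v -> phi v <= phi (dst e)) /\ (dst e == v -> phi v <= phi (src e)).
  split=> /eqP he; rewrite leNgt; apply/negP => hlt; apply: hN.
    exists (dst e); rewrite /downhill hlt andbT; apply/existsP; exists e.
    by rewrite he !eqxx.
  exists (src e); rewrite /downhill hlt andbT; apply/existsP; exists e.
  by rewrite he !eqxx orbT.
pose g x : R := (x == v)%:R.
pose t e := (phi (src e) - phi (dst e)) * (g (src e) - g (dst e)).
have t0 e : t e <= 0.
  have [h1 h2] := low e; rewrite /t /g.
  case: (boolP (src e == v)) => [hs|_]; case: (boolP (dst e == v)) => [hd|_] /=.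
  - lra.
  - by have := h1 hs; rewrite (eqP hs); lra.
  - by have := h2 hd; rewrite (eqP hd); lra.
  - lra.
have t1 : t e0 < 0.
  have uv' : u != v by apply: contraTneq uv => ->; rewrite ltxx.
  rewrite /t /g; case/orP: he0 => /andP[/eqP -> /eqP ->]; rewrite eqxx (negPf uv') /=; lra.
have : 0 <= g i - g j.
  by rewrite /g [j == v]eq_sym (negPf vj) subr0.
rewrite -H (bigD1 e0) //= => h.
have : \sum_(e | e != e0) t e <= 0 by apply: sumr_le0.
rewrite /t in t1 *; lra.
Qed.

Lemma downhill_connect phi i j u v : unit_flow phi i j -> downhill phi u v ->
  connect (downhill phi) v j.
Proof.
(* The induction is on the number of vertices strictly below [v], which drops at each downhill
   step. *)
move=> H; have [N] := ubnP #|[pred x | phi x < phi v]|.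
elim: N u v => // N IH u v; rewrite ltnS => hN uv.
have [->|vj] := eqVneq v j; first exact: connect0.
have [x vx] := downhill_step _ _ _ _ _ H uv vj.
apply: connect_trans (connect1 vx) (IH _ _ _ vx).
apply: leq_trans hN; apply: proper_card; apply/properP.
have xv : phi x < phi v by case/andP: vx.
split; first by apply/subsetP => y; rewrite !inE => /lt_trans; apply.
by exists x; rewrite !inE ?ltxx.
Qed.

(** Negating the potential exchanges source and sink and reverses the downhill relation. *)
Lemma uphill_connect phi i j u v : unit_flow phi i j -> downhill phi u v ->
  connect (downhill phi) i u.
Proof.
move=> /unit_flowN H uv.
have rev x y : downhill (fun x => - phi x) x y = downhill phi y x.
  by rewrite /downhill adj_sym ltrN2.
have vu : downhill (fun x => - phi x) v u by rewrite rev.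
have h := downhill_connect _ _ _ _ _ H vu.
rewrite connect_rev in h; apply: etrans h.
by apply: eq_connect => x y; exact: (esym (rev y x)).
Qed.

(* A path along which the potential decreases strictly is simple. *)
Lemma unit_flow_support phi i j e : unit_flow phi i j ->
  phi (src e) - phi (dst e) != 0 -> e \in Eset src dst i j.
Proof.
move=> H he.
have [u [v [uv euv]]] : exists u v, downhill phi u v /\
    (((u == src e) && (v == dst e)) || ((u == dst e) && (v == src e))).
  have hadj : adj src dst (src e) (dst e) by apply/existsP; exists e; rewrite !eqxx.
  rewrite subr_eq0 in he; case: (ltgtP (phi (src e)) (phi (dst e))) he => // h _.
    exists (dst e), (src e); rewrite /downhill h adj_sym hadj !eqxx orbT; by split.
  by exists (src e), (dst e); rewrite /downhill h hadj !eqxx.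
have /connectP[p1 hp1 lp1] := uphill_connect _ _ _ _ _ H uv.
have /connectP[p2 hp2 lp2] := downhill_connect _ _ _ _ _ H uv.
have hp : path (downhill phi) i (p1 ++ v :: p2).
  by rewrite cat_path hp1 /= -lp1 uv.
rewrite inE; apply/asboolP; exists (p1 ++ v :: p2); apply/and4P; split.
- by apply: sub_path hp => x y /andP[].
- have tr : transitive (fun x y => phi y < phi x).
    by move=> y x z xy yz; exact: lt_trans yz xy.
  apply: (sorted_uniq tr) => [x|]; first exact: ltxx.
  by apply: sub_path hp => x y /andP[].
- by rewrite last_cat /= -lp2.
- rewrite /edge_on; move: lp1; clear -euv; elim: p1 i => [|x p IH] i /= lp.
    by rewrite -lp euv.
  by rewrite (IH x lp) orbT.
Qed.

(** Cauchy-Schwarz after truncating [h] to the support of the flow, so that the edge count is that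
    of [Eset] instead of [m]. *)
Lemma unit_flow_dot phi i j (h : 'I_m -> R) (H : R) : unit_flow phi i j ->
  (forall e, `|h e| <= H) ->
  (\sum_e (phi (src e) - phi (dst e)) * h e) ^+ 2 <=
  (\sum_e (phi (src e) - phi (dst e)) ^+ 2) * (#|Eset src dst i j|%:R * H ^+ 2).
Proof.
move=> F hH; pose h' e := if e \in Eset src dst i j then h e else 0.
rewrite (eq_bigr (fun e => (phi (src e) - phi (dst e)) * h' e)); last first.
  move=> e _; rewrite /h'; case: (boolP (e \in _)) => // he; rewrite mulr0.
  have [->|/(unit_flow_support _ _ _ _ F)] := eqVneq (phi (src e) - phi (dst e)) 0.
    by rewrite mul0r.
  by rewrite (negPf he).
apply: le_trans (cauchy_schwarz _ _ _ _) _; apply: ler_wpM2l.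
  by apply: sumr_ge0 => e _; exact: sqr_ge0.
rewrite mulr_natl -sumr_const [leRHS]big_mkcond /=; apply: ler_sum => e _.
rewrite /h'; case: ifP => _; last by rewrite expr0n.
have := hH e; rewrite ler_norml; nra.
Qed.

Lemma unit_flow_energy_le phi i j : unit_flow phi i j ->
  \sum_e (phi (src e) - phi (dst e)) ^+ 2 <= #|Eset src dst i j|%:R.
Proof.
move=> F; rewrite -sumr_const [leRHS]big_mkcond /=; apply: ler_sum => e _.
have h1 := unit_flow_le1 _ _ _ e F.
case: ifPn => he; first by move: h1; rewrite ler_norml; nra.
have [->|/(unit_flow_support _ _ _ _ F)] := eqVneq (phi (src e) - phi (dst e)) 0.
  by rewrite expr0n.
by rewrite (negPf he).
Qed.

(** The indicator of [i] has edge differences in [[-1, 1]] and pairs to [1] with the flow. *)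
Lemma unit_flow_energy_ge phi i j : unit_flow phi i j -> i != j ->
  1 <= (\sum_e (phi (src e) - phi (dst e)) ^+ 2) * #|Eset src dst i j|%:R.
Proof.
move=> F ij; pose g x : R := (x == i)%:R.
have := unit_flow_dot _ _ _ (fun e => g (src e) - g (dst e)) 1 F.
rewrite F /g eqxx eq_sym (negPf ij) subr0 !expr1n mulr1; apply=> e.
by rewrite ler_norml; case: (_ == i); case: (_ == i) => /=; lra.
Qed.

(** * The pseudoinverse of the Laplacian as a source of unit flows *)

Hypothesis conn : connected_graph src dst.
Variable Ldag : 'M[R]_n.
Hypothesis pinv : is_MP_pinv (laplacian src dst) Ldag.

Let B : 'M[R]_(n, m) := incidence src dst.
Let L : 'M[R]_n := laplacian src dst.
Let d i j : 'cV[R]_n := delta_mx i 0 - delta_mx j 0.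

Lemma mul_incidence p (u : 'M[R]_(p, n)) r e :
  (u *m B) r e = u r (src e) - u r (dst e).
Proof.
rewrite mxE; under eq_bigr => x _ do rewrite mxE mulrBr !mulr_natr !mulrb.
by rewrite sumrB -!big_mkcond !big_pred1_eq.
Qed.

Lemma mul_dT p (A : 'M[R]_(n, p)) i j c : ((d i j)^T *m A) 0 c = A i c - A j c.
Proof.
rewrite mxE; under eq_bigr => x _ do
  rewrite !mxE andbT andbT mulrBl !mulr_natl !mulrb.
by rewrite sumrB -!big_mkcond !big_pred1_eq.
Qed.

(** The quadratic form of [L] at [x] is the sum of squared differences over edges; connectivity
    propagates the equalities. *)
Lemma laplacian_kernel (x : 'cV[R]_n) u v : L *m x = 0 -> x u 0 = x v 0.
Proof.
move=> Lx; have h : (x^T *m B) *m (x^T *m B)^T = 0.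
  by rewrite trmx_mul trmxK -mulmxA [B *m _]mulmxA -/L Lx mulmx0.
have hz e : x (src e) 0 = x (dst e) 0.
  have : \sum_e ((x^T *m B) 0 e) ^+ 2 = 0.
    have := congr1 (fun M : 'M[R]_1 => M 0 0) h; rewrite mxE [RHS]mxE => h0.
    by rewrite -[RHS]h0; apply: eq_bigr => e' _; rewrite expr2 [X in _ = _ * X]mxE.
  move/eqP; rewrite psumr_eq0 => [|e' _]; last exact: sqr_ge0.
  move/allP => /(_ e (mem_index_enum e)); rewrite sqrf_eq0 mul_incidence !mxE.
  by rewrite subr_eq0 => /eqP.
have /connectP[p hp ->] := conn u v.
elim: p u hp => //= y p IH u /andP[/existsP[e he] hp]; rewrite -(IH _ hp).
by case/orP: he => /andP[/eqP <- /eqP <-].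
Qed.

(** The columns of [1 - Ldag L] lie in the kernel of [L], hence are constant, and [d i j]
    annihilates constants. *)
Lemma pinv_laplacian i j : (d i j)^T *m Ldag *m L = (d i j)^T.
Proof.
have LM : L *m (1%:M - Ldag *m L) = 0.
  by case: pinv => h _ _ _; rewrite mulmxBr mulmx1 mulmxA h subrr.
have /eqP : (d i j)^T *m (1%:M - Ldag *m L) = 0.
  apply/rowP => c; rewrite mul_dT [RHS]mxE; apply/eqP; rewrite subr_eq0; apply/eqP.
  have := @laplacian_kernel (col c (1%:M - Ldag *m L)) i j.
  by rewrite colE mulmxA LM mul0mx -colE ![col _ _ _ _]mxE; exact.
by rewrite mulmxBr mulmx1 mulmxA subr_eq0 => /eqP.
Qed.

Definition potential i j x : R := ((d i j)^T *m Ldag) 0 x.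

Lemma potential_unit_flow i j : unit_flow (potential i j) i j.
Proof.
move=> g; pose G : 'cV[R]_n := \col_x g x.
transitivity (((d i j)^T *m Ldag *m B *m (G^T *m B)^T) 0 0).
  rewrite [RHS]mxE; apply: eq_bigr => e _.
  by rewrite [X in _ = _ * X]mxE !mul_incidence ![G^T _ _]mxE ![G _ _]mxE.
rewrite trmx_mul trmxK mulmxA -[_ *m B *m B^T]mulmxA -/L pinv_laplacian.
by rewrite mul_dT !mxE.
Qed.

Definition flow i j e : R := potential i j (src e) - potential i j (dst e).

(** Kirchhoff's law tested against the potential itself: energy equals potential drop. *)
Lemma flow_eff_res i j : \sum_e flow i j e ^+ 2 = eff_res Ldag i j.
Proof.
under eq_bigr => e _ do rewrite expr2.
rewrite (potential_unit_flow i j (potential i j)).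
transitivity (((d i j)^T *m Ldag *m d i j)^T 0 0); last by rewrite mxE.
by rewrite trmx_mul mul_dT ![(_ *m _)^T _ _]mxE.
Qed.

Lemma pinv_least_squares (h : 'cV[R]_m) i j :
  (Ldag *m B *m h) i 0 - (Ldag *m B *m h) j 0 = \sum_e flow i j e * h e 0.
Proof.
rewrite -mul_dT !mulmxA mxE; apply: eq_bigr => e _.
by rewrite mul_incidence.
Qed.

End ElectricalFlow.

(** * Log-odds, resistance sums and edge variances *)

Definition logit {R : realType} (p : R) : R := ln (p / (1 - p)).

Lemma logit_quad (R : realType) (p x : R) : 0 < p -> p < 1 ->
  `|x| <= p * (1 - p) / 2 ->
  [/\ 0 < p + x, p + x < 1 &
  `|logit (p + x) - logit p - x / (p * (1 - p))| <= 2 * (x / (p * (1 - p))) ^+ 2].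
Proof.
move=> p0 p1 hx; have q0 : 0 < 1 - p by lra.
have [hx1 hx2] : - (p * (1 - p) / 2) <= x /\ x <= p * (1 - p) / 2.
  by move: hx; rewrite ler_norml => /andP[].
have px0 : 0 < p + x by nra.
have px1 : p + x < 1 by nra.
split=> //.
have px10 : 0 < 1 - (p + x) by lra.
pose y := x / p; pose z := - (x / (1 - p)).
have hy : `|y| <= 2^-1.
  by rewrite normrM normfV (gtr0_norm p0) ler_pdivrMr //; nra.
have hz : `|z| <= 2^-1.
  by rewrite normrN normrM normfV (gtr0_norm q0) ler_pdivrMr //; nra.
have Ey : p + x = p * (1 + y) by rewrite /y; field; rewrite gt_eqF.
have Ez : 1 - (p + x) = (1 - p) * (1 + z) by rewrite /z; field; rewrite gt_eqF.
have y0 : 0 < 1 + y by rewrite -(pmulr_rgt0 _ p0) -Ey.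
have z0 : 0 < 1 + z by rewrite -(pmulr_rgt0 _ q0) -Ez.
rewrite /logit !ln_div ?posrE // Ez {1}Ey !lnM ?posrE //.
have -> : x / (p * (1 - p)) = y - z by rewrite /y /z; field; rewrite !gt_eqF.
(* The opposite signs give [y^2 + z^2 <= (y - z)^2], so the two logarithmic errors merge into one
   square. *)
have yz : y * z <= 0.
  rewrite /y /z mulrN oppr_le0 mulrACA -expr2 mulr_ge0 ?sqr_ge0 //.
  by rewrite mulr_ge0 // invr_ge0 ltW.
have := ln1D_quad _ _ hy; have := ln1D_quad _ _ hz.
rewrite !ler_norml => /andP[z1 z2] /andP[y1 y2]; apply/andP; split; nra.
Qed.

Lemma eff_res_sym (R : realType) (n : nat) (A : 'M[R]_n) i j :
  eff_res A i j = eff_res A j i.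
Proof.
by rewrite /eff_res /= -opprB mulmxN [(- _)^T]linearN /= !mulNmx opprK.
Qed.

Lemma sum_eff_res (R : realType) (n : nat) (A : 'M[R]_n) : (1 < n)%N ->
  \sum_(x : 'I_n * 'I_n | x.1 != x.2) eff_res A x.1 x.2 =
  2 * 'C(n, 2)%:R * Omega_avg A.
Proof.
move=> n2; rewrite /Omega_avg; set S := \sum_i _.
transitivity (2 * S); last by field; rewrite pnatr_eq0 -lt0n bin_gt0.
have -> : S = \sum_(x : 'I_n * 'I_n | (x.1 < x.2)%N) eff_res A x.1 x.2.
  by rewrite /S pair_big_dep.
have -> : \sum_(x : 'I_n * 'I_n | x.1 != x.2) eff_res A x.1 x.2 =
    \sum_(x : 'I_n * 'I_n | (x.1 < x.2)%N) eff_res A x.1 x.2 +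
    \sum_(x : 'I_n * 'I_n | (x.2 < x.1)%N) eff_res A x.1 x.2.
  rewrite (bigID (fun x : 'I_n * 'I_n => x.1 < x.2)%N) /=; congr (_ + _);
    by apply: eq_bigl => -[i j] /=; rewrite -val_eqE /=; case: ltngtP.
rewrite mulr_natl mulr2n; congr (_ + _).
rewrite (reindex_inj (h := fun x : 'I_n * 'I_n => (x.2, x.1))) => [|[a b] [c d] [-> ->]] //=.
by apply: eq_bigr => x _; exact: eff_res_sym.
Qed.

(** With endpoint weights [s] and [d], the inverse is [(s + d)^2 / (s d)], and the square of the
    larger weight is at most [b s d]. *)
Lemma pvar_inv (R : realType) (n m : nat) (src dst : 'I_m -> 'I_n) (w : 'cV[R]_n) b e :
  (forall i, 0 < w i 0) -> (forall i j, w i 0 / w j 0 <= b) ->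
  0 < pvar src dst w e /\ (pvar src dst w e)^-1 <= 4 * b.
Proof.
move=> w0 hb; have := pwin_gt0 src dst w w0 e; have := pwin_lt1 src dst w w0 e => p1 p0.
have v0 : 0 < pvar src dst w e by rewrite mulr_gt0 // subr_gt0.
split=> //; rewrite -[leLHS]mul1r ler_pdivrMr //.
have s0 := w0 (src e); have d0 := w0 (dst e).
have := hb (src e) (dst e); have := hb (dst e) (src e); have := hb (src e) (src e).
rewrite divff ?gt_eqF // !ler_pdivrMr // /pvar /pwin.
move: (w (src e) 0) (w (dst e) 0) s0 d0 => s d s0 d0 b1 h1 h2.
have -> : 4 * b * (s / (s + d) * (1 - s / (s + d))) = 4 * b * s * d / (s + d) ^+ 2.
  by field; rewrite gt_eqF // addr_gt0.
by rewrite ler_pdivlMr ?exprn_gt0 ?addr_gt0 //; nra.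
Qed.

(** * Concentration of the pairwise errors *)

Section Concentration.
Context {R : realType} {n m k : nat} (src dst : 'I_m -> 'I_n) (w : 'cV[R]_n).
Context (Ldag : 'M[R]_n) (b delta l Emax : R).
Hypothesis w_gt0 : forall i, 0 < w i 0.
Hypothesis w_ratio : forall i j, w i 0 / w j 0 <= b.
Hypothesis n_gt1 : (1 < n)%N.
Hypothesis simple : simple_graph src dst.
Hypothesis conn : connected_graph src dst.
Hypothesis pinv : is_MP_pinv (laplacian src dst) Ldag.
Hypothesis Emax_ge : forall i j, #|Eset src dst i j|%:R <= Emax.
Hypothesis delta_gt0 : 0 < delta.
Hypothesis delta_lt : delta <= 2^-1.
Hypothesis l_gt0 : 0 < l.
Hypothesis expRl : expR (- l) = delta / n%:R.
Hypothesis k_ge1 : 256 * b * l <= k%:R.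
Hypothesis k_ge2 : forall i j, 64 * eff_res Ldag i j * b * l <= k%:R.
Hypothesis k_ge3 : forall i j,
  Emax * eff_res Ldag i j * (128 * b * l) ^+ 2 <= k%:R ^+ 2.

Let v := pvar src dst w.
Let X (om : outcome m k) e := noise src dst w om e.
Let f i j e : R := flow src dst Ldag i j e.
(** [v e * r e] is [sqrt l] standard deviations of the win frequency on [e]. *)
Let r e : R := Num.sqrt (l / (k%:R * v e)).

(** When all frequencies are in [(0, 1)], this is the error of the estimated log-ratio of [i] and
    [j], written as a flow through the edge errors. *)
Definition deviation (om : outcome m k) i j : R :=
  \sum_e f i j e * (logit (Defs.frac om e) - logit (pwin src dst w e)).

Let b_ge1 : 1 <= b.
Proof.
have := w_ratio (Ordinal n_gt1) (Ordinal n_gt1); rewrite divff //.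
by rewrite gt_eqF.
Qed.

Let b_gt0 : 0 < b.
Proof. exact: lt_le_trans ltr01 b_ge1. Qed.

Let kR_gt0 : 0 < k%:R :> R.
Proof. by apply: lt_le_trans k_ge1; rewrite !mulr_gt0. Qed.

Let k_gt0 : (0 < k)%N.
Proof. by have := kR_gt0; rewrite ltr0n. Qed.

Let v_gt0 e : 0 < v e.
Proof. exact: (pvar_inv _ _ _ _ _ _ _ e w_gt0 w_ratio).1. Qed.

Let vV e : (v e)^-1 <= 4 * b.
Proof. exact: (pvar_inv _ _ _ _ _ _ _ e w_gt0 w_ratio).2. Qed.

Let sqr_r e : r e ^+ 2 = l / (k%:R * v e).
Proof. by rewrite /r sqr_sqrtr // ltW // (divr_gt0 l_gt0 (mulr_gt0 kR_gt0 (v_gt0 e))). Qed.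

Let r_le e : r e ^+ 2 <= 4 * b * l / k%:R.
Proof.
have kN : k%:R != 0 :> R by rewrite gt_eqF.
rewrite sqr_r invfM mulrA [leRHS](_ : _ = l / k%:R * (4 * b)); last by field.
by apply: ler_wpM2l => //; rewrite divr_ge0 // ltW.
Qed.

Let r_small e : 0 <= r e <= 8^-1.
Proof.
have r0 : 0 <= r e := sqrtr_ge0 _.
rewrite r0 /= -(@ler_pXn2r _ 2) ?nnegrE ?invr_ge0 //.
apply: le_trans (r_le e) _; rewrite ler_pdivrMr //.
have := k_ge1; lra.
Qed.

Lemma edge_tail e :
  Prob src dst w (fun om => 4 * v e * r e <= `|X om e|) <= 2 * expR (- (4 * l)).
Proof.
have ve := v_gt0 e; have /andP[r0 r8] := r_small e.
(* This tilt gives exponent [4 l] and turns the threshold [4 * v e * r e] into [8 l]. *)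
pose c e' := if e' == e then 2 * k%:R * r e else 0.
have S1 : \sum_e' pvar src dst w e' * c e' ^+ 2 / k%:R = 4 * l.
  rewrite (bigD1 e) //= big1 => [|e' /negPf ne]; last first.
    by rewrite /c ne expr0n mulr0 mul0r.
  by rewrite /c eqxx addr0 -/(v e) !exprMn sqr_r; field; rewrite !gt_eqF.
have S2 om : \sum_e' c e' * noise src dst w om e' = 2 * k%:R * r e * X om e.
  rewrite (bigD1 e) //= big1 => [|e' /negPf ne]; first by rewrite /c eqxx addr0.
  by rewrite /c ne mul0r.
have hc e' : `|c e'| <= 3^-1 * k%:R.
  rewrite /c; case: eqP => _; last by rewrite normr0 mulr_ge0 ?invr_ge0.
  rewrite ger0_norm ?mulr_ge0 //; have := kR_gt0; nra.
have r1 : 0 < r e by rewrite sqrtr_gt0 (divr_gt0 l_gt0 (mulr_gt0 kR_gt0 ve)).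
have -> : (fun om => 4 * v e * r e <= `|X om e|) =
    (fun om => 8 * l <= `|\sum_e' c e' * noise src dst w om e'|).
  apply/boolp.funext => om; rewrite S2 normrM ger0_norm ?mulr_ge0 //.
  rewrite -[LHS](ler_pM2l (x := 2 * k%:R * r e)) ?mulr_gt0 //; congr (_ <= _).
  rewrite [LHS](_ : _ = 8 * k%:R * v e * r e ^+ 2); last by ring.
  by rewrite sqr_r; field; rewrite !gt_eqF.
apply: le_trans (bernstein_tail src dst w w_gt0 k_gt0 c (8 * l) hc) _.
by rewrite S1 (_ : 4 * l - 8 * l = - (4 * l)) //; ring.
Qed.

Lemma pair_tail i j :
  Prob src dst w (fun om => 1 <= `|\sum_e f i j e / v e * X om e|) <=
  2 * expR (- (4 * l)).
Proof.
(* The threshold [1] becomes [8 l]; [k_ge1] puts [c] in the Bernstein range and [k_ge2] keeps the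
   variance term below [4 l]. *)
pose c e := 8 * l * (f i j e / v e).
have f1 e : `|f i j e| <= 1.
  exact: unit_flow_le1 (potential_unit_flow _ _ conn _ pinv i j).
have hc e : `|c e| <= 3^-1 * k%:R.
  rewrite normrM ger0_norm ?mulr_ge0 ?(ltW l_gt0) //.
  rewrite normrM normfV (gtr0_norm (v_gt0 e)).
  have h : `|f i j e| / v e <= 1 * (4 * b).
    by apply: ler_pM => //; rewrite ?invr_ge0 // ltW.
  apply: le_trans (ler_wpM2l _ h) _; first by rewrite mulr_ge0 // ltW.
  have := k_ge1; have : 0 <= b * l by rewrite mulr_ge0 ?(ltW l_gt0) // (le_trans ler01).
  lra.
have := bernstein_tail src dst w w_gt0 k_gt0 c (8 * l) hc.
have -> : (fun om : outcome m k => 8 * l <= `|\sum_e c e * noise src dst w om e|) =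
   (fun om => 1 <= `|\sum_e f i j e / v e * X om e|).
  apply/boolp.funext => om.
  under eq_bigr => e _ do rewrite /c -mulrA.
  rewrite -mulr_sumr normrM ger0_norm ?mulr_ge0 ?(ltW l_gt0) //.
  by rewrite -[X in X <= _]mulr1 ler_pM2l // mulr_gt0.
move=> h; apply: le_trans h _; rewrite ler_wpM2l // ler_expR.
have h : \sum_e pvar src dst w e * c e ^+ 2 / k%:R <=
    64 * l ^+ 2 / k%:R * (4 * b) * \sum_e f i j e ^+ 2.
  rewrite mulr_sumr; apply: ler_sum => e _; rewrite -/(v e).
  rewrite [leLHS](_ : _ = 64 * l ^+ 2 / k%:R * (v e)^-1 * f i j e ^+ 2); last first.
    by rewrite /c; field; rewrite !gt_eqF.
  apply: ler_wpM2r; first exact: sqr_ge0.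
  by apply: ler_wpM2l => //; rewrite divr_ge0 // mulr_ge0 // sqr_ge0.
have hk : 64 * l ^+ 2 / k%:R * (4 * b) * eff_res Ldag i j <= 4 * l.
  rewrite [leLHS](_ : _ = 4 * l * (64 * eff_res Ldag i j * b * l) / k%:R); last first.
    by field; rewrite gt_eqF.
  by rewrite ler_pdivrMr // ler_wpM2l // mulr_ge0 // ltW.
rewrite (flow_eff_res _ _ conn _ pinv) in h; lra.
Qed.

Lemma edges_le : (m <= n ^ 2)%N.
Proof.
have inj : injective (fun e => (src e, dst e)).
  by move=> e e' [h1 h2]; apply: (simple.2); rewrite h1 h2 !eqxx.
by have := leq_card _ inj; rewrite card_prod !card_ord.
Qed.

Let union_small (N : nat) : (N <= n ^ 2)%N ->
  N%:R * (2 * expR (- (4 * l))) <= delta / 3.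
Proof.
move=> hN; have n0 : 0 < n%:R :> R by rewrite ltr0n ltnW.
apply: (@le_trans _ _ ((n ^ 2)%:R * (2 * expR (- (4 * l))))).
  by apply: ler_wpM2r; rewrite ?mulr_ge0 ?expR_ge0 // ler_nat.
(* [expR (- (4 l))] is [(delta / n)^4], small enough to pay for [n^2] events. *)
rewrite -mulrN expRM_natl expRl natrX.
rewrite [leLHS](_ : _ = delta * (2 * delta ^+ 3) / n%:R ^+ 2); last first.
  by field; rewrite gt_eqF.
rewrite ler_pdivrMr ?exprn_gt0 //.
have n2 : 2 <= n%:R :> R by rewrite ler_nat.
have n4 : 4 <= n%:R ^+ 2 :> R by nra.
have d3 : 2 * delta ^+ 3 <= 1.
  have d2 : delta ^+ 2 <= 1 by have := delta_gt0; have := delta_lt; nra.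
  have := delta_lt; have := delta_gt0; rewrite exprS; nra.
have : delta * (2 * delta ^+ 3) <= delta by rewrite ler_piMr // ltW.
have := delta_gt0; nra.
Qed.

Lemma log_odds_error om e : `|X om e| < 4 * v e * r e ->
  [/\ 0 < Defs.frac om e :> R, Defs.frac om e < 1 :> R &
   `|logit (Defs.frac om e) - logit (pwin src dst w e) - X om e / v e|
     <= 128 * b * l / k%:R].
Proof.
move=> hX; have /andP[r0 r8] := r_small e; have ve := v_gt0 e.
have hX2 : `|X om e| <= v e / 2 by apply: le_trans (ltW hX) _; nra.
have [] := logit_quad _ _ _ (pwin_gt0 src dst w w_gt0 e) (pwin_lt1 src dst w w_gt0 e) hX2.
rewrite /X /noise subrKC => h0 h1 h2; split => //; apply: le_trans h2 _.
change (2 * (X om e / v e) ^+ 2 <= 128 * b * l / k%:R).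
have : `|X om e / v e| <= 4 * r e.
  by rewrite normrM normfV (gtr0_norm ve) ler_pdivrMr // mulrAC ltW.
have := r_le e; rewrite ler_norml => hr /andP[y1 y2].
have : (X om e / v e) ^+ 2 <= 16 * r e ^+ 2 by nra.
lra.
Qed.

Lemma deviation_split om i j : (forall e, `|X om e| < 4 * v e * r e) ->
  exists2 Z, deviation om i j = \sum_e f i j e / v e * X om e + Z &
    Z ^+ 2 <= eff_res Ldag i j * (Emax * (128 * b * l / k%:R) ^+ 2).
Proof.
move=> hX; pose h e := logit (Defs.frac om e) - logit (pwin src dst w e) - X om e / v e.
exists (\sum_e f i j e * h e).
  by rewrite -big_split /=; apply: eq_bigr => e _; rewrite /h; ring.
have he e : `|h e| <= 128 * b * l / k%:R by have [] := log_odds_error om e (hX e).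
apply: le_trans (unit_flow_dot _ _ _ _ _ _ _ (potential_unit_flow _ _ conn _ pinv i j) he) _.
rewrite flow_eff_res //; apply: ler_wpM2l.
  by rewrite -(flow_eff_res _ _ conn _ pinv); apply: sumr_ge0 => e _; exact: sqr_ge0.
by apply: ler_wpM2r; rewrite ?sqr_ge0.
Qed.

(** Three bad events share [delta]: a large error on some edge, a large linear part for some pair, a
    large weighted quadratic form. Outside them the remainder of each deviation is at most [1] by
    [k_ge3]. *)
Lemma concentration (q : 'I_n * 'I_n -> R) (D : pred (outcome m k))
    (Q := \sum_(x | x.1 != x.2) q x * eff_res Ldag x.1 x.2) :
  (forall x, 0 < q x) ->
  (forall om, (forall e, 0 < (Defs.frac om e : R) < 1) ->
    (forall i j, `|deviation om i j| <= 2) ->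
    \sum_(x | x.1 != x.2) q x * deviation om x.1 x.2 ^+ 2 <=
      2 * (768 * expR 1 ^+ 2 * (1 + ln delta^-1) * b ^+ 2 / k%:R * Q) +
      2 * (Q * (Emax * (128 * b * l / k%:R) ^+ 2)) -> D om) ->
  1 - delta <= Prob src dst w D.
Proof.
move=> q0 hD.
have F i j := potential_unit_flow _ _ conn _ pinv i j.
have O_gt0 i j : i != j -> 0 < eff_res Ldag i j.
  move=> ij; have := unit_flow_energy_ge _ _ _ _ _ (F i j) ij.
  rewrite (flow_eff_res _ _ conn _ pinv) => h.
  rewrite ltNge; apply/negP => hle; have := ler0n R #|Eset src dst i j|; nra.
pose cc (x : 'I_n * 'I_n) e := f x.1 x.2 e / v e.
pose Q' := \sum_(x | x.1 != x.2) q x * \sum_e cc x e ^+ 2.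
have cc_gt0 x : x.1 != x.2 -> 0 < \sum_e cc x e ^+ 2.
  move=> hx; have := O_gt0 _ _ hx; rewrite -(flow_eff_res _ _ conn _ pinv).
  rewrite !lt_def !sumr_ge0 ?andbT; try by move=> *; exact: sqr_ge0.
  apply: contra; rewrite !psumr_eq0; try by move=> *; exact: sqr_ge0.
  move=> /allP h; apply/allP => e /h; rewrite !sqrf_eq0 /cc /f mulf_eq0.
  by rewrite invr_eq0 (gt_eqF (v_gt0 e)) orbF.
have Q'_gt0 : 0 < Q'.
  have i01 : Ordinal (ltnW n_gt1) != Ordinal n_gt1 by [].
  rewrite /Q' (bigD1 (Ordinal (ltnW n_gt1), Ordinal n_gt1)) //= ltr_wpDr //.
    by apply: sumr_ge0 => x /andP[hx _]; rewrite mulr_ge0 ?ltW // cc_gt0.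
  by rewrite mulr_gt0 // cc_gt0.
have Q'_le : Q' <= 16 * b ^+ 2 * Q.
  rewrite /Q mulr_sumr; apply: ler_sum => x _; rewrite mulrCA; apply: ler_wpM2l.
    exact: ltW.
  rewrite -(flow_eff_res _ _ conn _ pinv) mulr_sumr; apply: ler_sum => e _.
  rewrite /cc exprMn mulrC; apply: ler_wpM2r; first exact: sqr_ge0.
  have := vV e; have : 0 < (v e)^-1 by rewrite invr_gt0.
  nra.
(* The shift by [3] makes [2 * expR (- p)] at most [delta / 4], since [expR (- 3) <= 1 / 8]. *)
pose p := (Num.truncn (ln delta^-1 + 3)).+1.
have ln0 : 0 <= ln delta^-1.
  by rewrite ln_ge0 // invf_ge1 //; apply: le_trans delta_lt _; lra.
have [p1 p2] : p%:R <= ln delta^-1 + 4 /\ ln delta^-1 + 3 <= p%:R.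
  have /andP[h1 h2] : (Num.truncn (ln delta^-1 + 3))%:R <= ln delta^-1 + 3 <
      (Num.truncn (ln delta^-1 + 3)).+1%:R by apply: truncn_itv; lra.
  by rewrite /p; split; [rewrite -natr1; lra | exact: ltW].
have hp : 2 * expR (- p%:R) <= delta / 3.
  have h : expR (- p%:R) <= delta * expR (- 3).
    have -> : delta = expR (- ln delta^-1) by rewrite lnV ?posrE // opprK lnK.
    by rewrite -expRD ler_expR; lra.
  have e3 : expR (- 3) <= 8^-1 :> R.
    rewrite expRN lef_pV2 ?posrE ?expR_gt0 // -[X in expR X]mulr1 expRM_natl.
    rewrite [leLHS](_ : _ = 2 ^+ 3); last by rewrite -natrX.
    by apply: lerXn2r; rewrite ?nnegrE ?expR_ge0 //; have := expR_ge1Dx (1 : R); lra.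
  have := delta_gt0; have := expR_gt0 (- 3 : R); nra.
apply: (Prob_good src dst w w_gt0 (fun om => [exists e, 4 * v e * r e <= `|X om e|])
  (fun om => [exists x : 'I_n * 'I_n, 1 <= `|\sum_e cc x e * X om e|])
  (fun om => 12 * expR 1 ^+ 2 * p%:R * Q' / k%:R <
     \sum_(x | x.1 != x.2) q x * (\sum_e cc x e * X om e) ^+ 2)).
- apply: le_trans (Prob_union src dst w w_gt0 _ (fun e om => 4 * v e * r e <= `|X om e|) _ edge_tail) _.
  by rewrite card_ord union_small ?edges_le.
- apply: le_trans (Prob_union src dst w w_gt0 _ (fun x om => 1 <= `|\sum_e cc x e * X om e|) _
    (fun x => pair_tail x.1 x.2)) _.
  by rewrite card_prod card_ord union_small.
- apply: le_trans hp; apply: quadratic_tail => // x; exact: ltW.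
move=> om; rewrite negb_exists => /forallP hA; rewrite negb_exists => /forallP hB.
rewrite -leNgt => hC.
have hX e : `|X om e| < 4 * v e * r e by rewrite ltNge.
apply: hD => [e|i j|].
- by have [-> ->] := log_odds_error om e (hX e).
- have [Z -> hZ] := deviation_split om i j hX.
  have := hB (i, j); rewrite -ltNge => /ltW h.
  apply: le_trans (ler_normD _ _) _; rewrite -[leRHS](_ : 1 + 1 = 2); last by [].
  apply: lerD; first exact: h.
  rewrite -(@ler_pXn2r _ 2) ?nnegrE // -normrX ger0_norm ?sqr_ge0 // expr1n.
  apply: le_trans hZ _.
  rewrite [leLHS](_ : _ = Emax * eff_res Ldag i j * (128 * b * l) ^+ 2 / k%:R ^+ 2).
    by rewrite ler_pdivrMr ?exprn_gt0 // mul1r; exact: k_ge3.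
  by field; rewrite gt_eqF.
apply: (@le_trans _ _ (2 * (\sum_(x | x.1 != x.2) q x * (\sum_e cc x e * X om e) ^+ 2) +
   2 * (Q * (Emax * (128 * b * l / k%:R) ^+ 2)))).
  rewrite mulr_suml !mulr_sumr -big_split /=; apply: ler_sum => x _.
  have [Z -> hZ] := deviation_split om x.1 x.2 hX.
  have qx := ltW (q0 x).
  rewrite -[q x * eff_res _ _ _ * _]mulrA [2 * (q x * _)]mulrCA [2 * (q x * _)]mulrCA.
  rewrite -mulrDr; apply: ler_wpM2l => //.
  rewrite -/(cc x); move: hZ (\sum_e _) => hZ Y; have := sqr_ge0 (Y - Z); nra.
rewrite lerD2r ler_wpM2l //; apply: le_trans hC _.
(* The constant [768] is [12 * 4 * 16]: moment bound, [p <= 4 * (1 + ln delta^-1)], and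
   [Q' <= 16 * b ^+ 2 * Q]. *)
rewrite [leRHS](_ : _ = 12 * expR 1 ^+ 2 * (4 * (1 + ln delta^-1)) *
   (16 * b ^+ 2 * Q) / k%:R); last by field; rewrite gt_eqF.
apply: ler_wpM2r; first by rewrite invr_ge0 ltW.
have e2 : 0 <= 12 * expR 1 ^+ 2 :> R by rewrite mulr_ge0 ?sqr_ge0.
apply: ler_pM => //; first by rewrite mulr_ge0.
  exact: ltW.
by apply: ler_wpM2l => //; lra.
Qed.

End Concentration.

(** * From pairwise errors to the sine, for a fixed good outcome *)

Section Deterministic.
Context {R : realType} {n m k : nat} (src dst : 'I_m -> 'I_n) (w : 'cV[R]_n).
Context (Ldag : 'M[R]_n) (b : R) (arb : outcome m k -> 'cV[R]_n).
Hypothesis w_gt0 : forall i, 0 < w i 0.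
Hypothesis w_ratio : forall i j, w i 0 / w j 0 <= b.
Hypothesis n_gt1 : (1 < n)%N.
Hypothesis conn : connected_graph src dst.
Hypothesis pinv : is_MP_pinv (laplacian src dst) Ldag.
Variable om : outcome m k.
Hypothesis frac_in : forall e, 0 < (Defs.frac om e : R) < 1.
Hypothesis dev2 : forall i j, `|deviation src dst w Ldag om i j| <= 2.

Let dev i j := deviation src dst w Ldag om i j.
Let wt i : R := w i 0 ^+ 2 / dotv w w.

Lemma logit_pwin e : logit (pwin src dst w e) = ln (w (src e) 0) - ln (w (dst e) 0).
Proof.
have s0 := w_gt0 (src e); have d0 := w_gt0 (dst e).
have sd := addr_gt0 s0 d0.
rewrite /logit -ln_div ?posrE //; congr ln; rewrite /pwin.
set s := w (src e) 0 in s0 sd *; set d := w (dst e) 0 in d0 sd *.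
have -> : 1 - s / (s + d) = d / (s + d) by field; rewrite gt_eqF.
by field; rewrite !gt_eqF.
Qed.

Let a i : R := (Ldag *m incidence src dst *m logR om) i 0 - ln (w i 0).

Let a_dev i j : a i - a j = dev i j.
Proof.
transitivity (\sum_e flow src dst Ldag i j e * (logR om e 0 -
    (ln (w (src e) 0) - ln (w (dst e) 0)))).
  under eq_bigr => e _ do rewrite mulrBr.
  rewrite sumrB -pinv_least_squares /a.
  (* Kirchhoff's law tested with [ln w] recovers the true log-ratio exactly. *)
  have -> := potential_unit_flow _ _ conn _ pinv i j (fun x => ln (w x 0)).
  ring.
by apply: eq_bigr => e _; rewrite mxE logit_pwin.
Qed.

Let sum_pairs (q : 'I_n -> 'I_n -> R) :
  \sum_i \sum_j q i j * (a i - a j) ^+ 2 =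
  \sum_(x | x.1 != x.2) q x.1 x.2 * dev x.1 x.2 ^+ 2.
Proof.
rewrite pair_bigA /= (bigID (fun x : 'I_n * 'I_n => x.1 != x.2)) /=.
rewrite [X in _ + X]big1 ?addr0 => [|x]; last first.
  by rewrite negbK => /eqP ->; rewrite subrr expr0n mulr0.
by apply: eq_bigr => x _; rewrite a_dev.
Qed.

Let ww_gt0 : 0 < dotv w w.
Proof.
rewrite dotvE (bigD1 (Ordinal n_gt1)) //= ltr_wpDr ?mulr_gt0 //.
by apply: sumr_ge0 => i _; rewrite mulr_ge0 // ltW.
Qed.

Let estimatorE i : estimator src dst Ldag arb om i 0 = w i 0 * expR (a i).
Proof.
rewrite /estimator ifT; last by apply/forallP.
by rewrite mxE /a expRB lnK ?posrE // mulrC divfK ?gt_eqF.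
Qed.

Let a_le i j : `|a i - a j| <= 2.
Proof. by rewrite a_dev. Qed.

Lemma sin_angle_max : sin_angle (estimator src dst Ldag arb om) w ^+ 2 <=
  expR 4 / 2 * \sum_(x | x.1 != x.2) wt x.1 * wt x.2 * dev x.1 x.2 ^+ 2.
Proof.
rewrite -(sum_pairs (fun i j => wt i * wt j)).
exact: sin_angle_le (ltnW n_gt1) w_gt0 estimatorE a_le.
Qed.

Lemma sin_angle_avg : sin_angle (estimator src dst Ldag arb om) w ^+ 2 <=
  expR 4 / 2 * \sum_(x : 'I_n * 'I_n | x.1 != x.2)
    4 * b ^+ 2 / n%:R ^+ 2 * dev x.1 x.2 ^+ 2.
Proof.
rewrite -(sum_pairs (fun i j => 4 * b ^+ 2 / n%:R ^+ 2)).
apply: le_trans (sin_angle_le _ _ _ _ _ (ltnW n_gt1) w_gt0 estimatorE a_le) _.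
apply: ler_wpM2l; first by rewrite divr_ge0 ?expR_ge0.
(* The bound on the weights is taken with [B = b ^+ 2]: each [w_i^2] is at most [b^2] times the mean
   of the [w_j^2]. *)
apply: (weighted_dispersion _ _ wt) => [|i||i]; first exact: ltnW.
- by rewrite /wt divr_ge0 ?sqr_ge0 // ltW.
- rewrite /wt -mulr_suml [X in _ / X]dotvE divff //.
  by rewrite -dotvE gt_eqF.
rewrite /wt ler_pdivrMr // mulrAC ler_pdivlMr ?ltr0n ?(ltnW n_gt1) //.
rewrite mulr_natr -[X in _ *+ X](card_ord n) -sumr_const dotvE mulr_sumr.
apply: ler_sum => j _; rewrite -!expr2 -exprMn; apply: lerXn2r.
- by rewrite nnegrE ltW.
- by rewrite nnegrE mulr_ge0 ?(ltW (w_gt0 _)) // -(@ler_pM2r _ (w j 0)) //;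
    rewrite mul0r (le_trans (ltW (w_gt0 j))) // -ler_pdivrMr // w_ratio.
- by rewrite -ler_pdivrMr // w_ratio.
Qed.

End Deterministic.

(** * Choice of the constants and assembly *)

Lemma estimator_sin_bound (R : realType) :
  exists c1 c2 c3 C0 : R, [/\ 0 < c1, 0 < c2, 0 < c3 & 0 < C0] /\
  forall (n m : nat) (src dst : 'I_m -> 'I_n),
    (2 <= n)%N ->
    simple_graph src dst ->
    connected_graph src dst ->
  forall (Ldag : 'M[R]_n),
    is_MP_pinv (laplacian src dst) Ldag ->
  forall (w : 'cV[R]_n) (b delta Cnd : R) (k : nat),
    (forall i, 0 < w i 0) ->
    (forall i j, w i 0 / w j 0 <= b) ->
    0 < delta -> delta < expR (-1) ->
    c1 * ln (n%:R / delta) <= Cnd ->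
    c2 * (E_max src dst)%:R * Cnd ^+ 2 <= k%:R ->
    c3 * Omega_max Ldag * b ^+ 2 * (1 + ln (delta^-1)) <= k%:R ->
  forall (arb : outcome m k -> 'cV[R]_n),
    1 - delta <=
    Prob src dst w (fun om =>
      sin_angle (estimator src dst Ldag arb om) w ^+ 2 <=
      C0 * Num.min (b ^+ 2 * Omega_max Ldag) (b ^+ 4 * Omega_avg Ldag) / k%:R
         * ((1 + ln (delta^-1)) + (E_max src dst)%:R * Cnd ^+ 2 / k%:R)).
Proof.
(* The two coefficients in the conclusion of [concentration], with [1536 = 2 * 768]. *)
pose C1 : R := 1536 * expR 1 ^+ 2 + 2 * 128 ^+ 2.
have C1_ge1 : 1536 * expR 1 ^+ 2 <= C1 by rewrite lerDl mulr_ge0 // exprn_ge0.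
have C1_gt0 : 0 < C1.
  by rewrite ltr_wpDl ?mulr_gt0 ?exprn_gt0 // mulr_ge0 // sqr_ge0.
have C1_ge2 : 2 * 128 ^+ 2 <= C1 by rewrite lerDr mulr_ge0 ?sqr_ge0.
exists 1, 256, 256, (2 * expR 4 * C1); split.
  by split; rewrite // !mulr_gt0 ?expR_gt0.
move=> n m src dst n_gt1 simple conn Ldag pinv w b delta C k w_gt0 w_ratio
  delta_gt0 delta_lt hC hk2 hk3 arb.
have n0 : 0 < n%:R :> R by rewrite ltr0n ltnW.
have n1 : 1 <= n%:R :> R by rewrite ler1n ltnW.
have b_ge1 : 1 <= b.
  have := w_ratio (Ordinal n_gt1) (Ordinal n_gt1).
  by rewrite divff // gt_eqF.
have delta_le : delta <= 2^-1.
  apply: le_trans (ltW delta_lt) _.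
  rewrite expRN lef_pV2 ?posrE ?expR_gt0 //.
  by have := expR_ge1Dx (1 : R); lra.
set E : R := (E_max src dst)%:R in hk2 *.
set O := Omega_max Ldag in hk3 *.
pose l := ln (n%:R / delta).
have expRl : expR (- l) = delta / n%:R by rewrite expRN lnK ?posrE ?divr_gt0 // invf_div.
have ln0 : 0 <= ln delta^-1 by rewrite ln_ge0 // invf_ge1 //; lra.
have l_gt0 : 0 < l.
  rewrite ln_gt0 // ltr_pdivlMr // mul1r; lra.
have lC : l <= C by rewrite -[l]mul1r.
have F i j := potential_unit_flow _ _ conn _ pinv i j.
have EO i j : eff_res Ldag i j = \sum_e flow src dst Ldag i j e ^+ 2.
  by rewrite (flow_eff_res _ _ conn _ pinv).
have Eset_le i j : #|Eset src dst i j|%:R <= E.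
  rewrite /E ler_nat; apply: leq_trans (leq_bigmax (F := fun j => #|Eset src dst i j|) j) _.
  exact: (leq_bigmax (F := fun i => \max_j #|Eset src dst i j|) i).
have O_ge i j : eff_res Ldag i j <= O.
  apply: le_trans (le_bigmax 0 (eff_res Ldag i) j) _.
  exact: (le_bigmax 0 (fun i => \big[Num.max/0]_j eff_res Ldag i j) i).
have O_le : O <= E.
  apply: bigmax_le => // i _; apply: bigmax_le => // j _.
  by rewrite EO; apply: le_trans (unit_flow_energy_le _ _ _ _ _ (F i j)) _.
have O_ge0 : 0 <= O.
  by apply: le_trans (O_ge (Ordinal n_gt1) (Ordinal n_gt1));
    rewrite EO sumr_ge0 // => e _; exact: sqr_ge0.
have E_ge0 : 0 <= E by [].
have OE1 : 1 <= O * E.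
  have i01 : Ordinal (ltnW n_gt1) != Ordinal n_gt1 by [].
  apply: le_trans (unit_flow_energy_ge _ _ _ _ _ (F _ _) i01) _.
  by apply: ler_pM => //; rewrite -?EO // EO sumr_ge0 // => e _; exact: sqr_ge0.
(* The product of the two assumptions on [k]. With [1 <= O * E] it yields [k_ge1], with [O <= E] it
   yields [k_ge2], and directly [k_ge3]. *)
have hkk : O * E * (256 * b * l) ^+ 2 <= k%:R ^+ 2.
  have h1 : 256 * E * l ^+ 2 <= k%:R.
    by apply: le_trans hk2; rewrite ler_wpM2l ?mulr_ge0 //; nra.
  have h2 : 256 * O * b ^+ 2 <= k%:R.
    by apply: le_trans hk3; rewrite ler_peMr ?mulr_ge0 ?sqr_ge0 //; lra.
  have h3 : 0 <= 256 * E * l ^+ 2 by rewrite mulr_ge0 ?sqr_ge0 // mulr_ge0.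
  have h4 : 0 <= 256 * O * b ^+ 2 by rewrite mulr_ge0 ?sqr_ge0 // mulr_ge0.
  have := ler_pM h3 h4 h1 h2; apply: le_trans.
  by rewrite le_eqVlt; apply/orP; left; apply/eqP; ring.
have bl0 : 0 < b * l by rewrite mulr_gt0 // (lt_le_trans ltr01).
have k_ge1 : 256 * b * l <= k%:R.
  rewrite -(@ler_pXn2r _ 2) ?nnegrE //; last by rewrite -mulrA mulr_ge0 // ltW.
  by apply: le_trans hkk; rewrite ler_peMl ?sqr_ge0.
have k_gt0 : 0 < k%:R :> R by apply: lt_le_trans k_ge1; rewrite -mulrA mulr_gt0.
have k_ge2 i j : 64 * eff_res Ldag i j * b * l <= k%:R.
  have h : 256 * O * b * l <= k%:R.
    rewrite -(@ler_pXn2r _ 2) ?nnegrE //; last first.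
      by rewrite -mulrA (mulr_ge0 _ (ltW bl0)) // mulr_ge0.
    apply: le_trans hkk.
    rewrite [leLHS](_ : _ = O * O * (256 * b * l) ^+ 2); last by ring.
    by rewrite ler_wpM2r ?sqr_ge0 // ler_wpM2l.
  apply: le_trans h; rewrite -!(mulrA _ b l).
  by apply: ler_wpM2r; [exact: ltW | have := O_ge i j; lra].
have k_ge3 i j : E * eff_res Ldag i j * (128 * b * l) ^+ 2 <= k%:R ^+ 2.
  apply: le_trans hkk; rewrite [O * E]mulrC; apply: ler_pM => //.
  - by rewrite mulr_ge0 // EO sumr_ge0 // => e _; exact: sqr_ge0.
  - exact: sqr_ge0.
  - by rewrite ler_wpM2l.
  - by rewrite !exprMn; have := sqr_ge0 b; have := sqr_ge0 l; nra.
have conc q D := @concentration R n m k src dst w Ldag b delta l E w_gt0 w_ratio n_gt1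
  simple conn pinv Eset_le delta_gt0 delta_le l_gt0 expRl k_ge1 k_ge2 k_ge3 q D.
set T := 1 + ln delta^-1 + E * C ^+ 2 / k%:R.
have T0 : 0 <= T by rewrite addr_ge0 ?addr_ge0 // divr_ge0 // mulr_ge0 // sqr_ge0.
have bound Q : 0 <= Q ->
    2 * (768 * expR 1 ^+ 2 * (1 + ln delta^-1) * b ^+ 2 / k%:R * Q) +
    2 * (Q * (E * (128 * b * l / k%:R) ^+ 2)) <= C1 * (b ^+ 2 * Q / k%:R) * T.
  move=> Q0; have u0 : 0 <= b ^+ 2 * Q / k%:R by rewrite divr_ge0 // mulr_ge0 // sqr_ge0.
  rewrite [leLHS](_ : _ = b ^+ 2 * Q / k%:R * (1536 * expR 1 ^+ 2 * (1 + ln delta^-1) +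
    (2 * 128 ^+ 2) * (E * l ^+ 2 / k%:R))); last by field; rewrite gt_eqF.
  rewrite [leRHS](_ : _ = b ^+ 2 * Q / k%:R * (C1 * T)); last by ring.
  apply: ler_wpM2l => //.
  rewrite /T [leRHS]mulrDr; apply: lerD; first by apply: ler_wpM2r => //; lra.
  have E0 : 0 <= E * l ^+ 2 / k%:R by rewrite divr_ge0 // mulr_ge0 // sqr_ge0.
  apply: (le_trans (ler_wpM2r E0 C1_ge2)).
  apply: ler_wpM2l; first exact: ltW.
  apply: ler_wpM2r; first by rewrite invr_ge0 ltW.
  by apply: ler_wpM2l => //; nra.
have O_i_ge0 i j : 0 <= eff_res Ldag i j.
  by rewrite EO sumr_ge0 // => e _; exact: sqr_ge0.
have e4 : 0 < expR 4 :> R := expR_gt0 4.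
(* [Z] stands for either term of the minimum; the slack [4] is the one in the uniform weights
   [4 b^2 / n^2]. *)
have fin x S Q Z : 0 <= Q -> b ^+ 2 * Q <= 4 * Z ->
    S <= C1 * (b ^+ 2 * Q / k%:R) * T -> x <= expR 4 / 2 * S ->
    x <= 2 * expR 4 * C1 * Z / k%:R * T.
  move=> Q0 QZ hS hx; apply: le_trans hx _.
  apply: le_trans (ler_wpM2l _ hS) _; first by rewrite divr_ge0 // ltW.
  rewrite [leLHS](_ : _ = expR 4 / 2 * C1 * T / k%:R * (b ^+ 2 * Q)); last by ring.
  rewrite [leRHS](_ : _ = expR 4 / 2 * C1 * T / k%:R * (4 * Z)); last by field; rewrite gt_eqF.
  apply: ler_wpM2l => //; rewrite divr_ge0 // mulr_ge0 // mulr_ge0 ?divr_ge0 //; exact: ltW.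
have ww_gt0 : 0 < dotv w w.
  rewrite dotvE (bigD1 (Ordinal n_gt1)) //= ltr_wpDr ?mulr_gt0 //.
  by apply: sumr_ge0 => i _; rewrite mulr_ge0 // ltW.
(* The minimum does not depend on the outcome, so only the weights of the smaller term are used and
   no probability is spent on the other. *)
case: (leP (b ^+ 2 * O) (b ^+ 4 * Omega_avg Ldag)) => _.
  pose wt i := w i 0 ^+ 2 / dotv w w.
  have wt0 i : 0 < wt i by rewrite divr_gt0 ?exprn_gt0.
  have wtwt x : 0 <= wt x.1 * wt x.2 by apply: mulr_ge0; exact: ltW.
  have wt1 : \sum_i wt i = 1.
    by rewrite -mulr_suml [X in _ / X]dotvE divff // -dotvE gt_eqF.
  apply: (conc (fun x => wt x.1 * wt x.2)) => [x|om hfrac hdev hsum].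
    by rewrite mulr_gt0.
  set Q := \sum_(x | _) _ * eff_res _ _ _ in hsum.
  have Q0 : 0 <= Q by apply: sumr_ge0 => x _; exact: mulr_ge0.
  apply: (fin _ _ Q _ Q0 _ (le_trans hsum (bound Q Q0))); last first.
    exact: (sin_angle_max _ _ _ _ _ w_gt0 n_gt1 conn pinv _ hfrac hdev).
  have QO : Q <= O.
    apply: (@le_trans _ _ (\sum_(x : 'I_n * 'I_n) wt x.1 * wt x.2 * O)).
      rewrite [leRHS](bigID (fun x : 'I_n * 'I_n => x.1 != x.2)) /=.
      apply: ler_wpDr.
        by apply: sumr_ge0 => x _; exact: mulr_ge0.
      by apply: ler_sum => x _; exact: ler_wpM2l.
    rewrite -mulr_suml -(pair_bigA _ (fun i j => wt i * wt j)) /=.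
    by under eq_bigr => i _ do rewrite -mulr_sumr wt1 mulr1; rewrite wt1 mul1r.
  have := ler_wpM2l (sqr_ge0 b) QO; have := mulr_ge0 (sqr_ge0 b) O_ge0; lra.
pose q : R := 4 * b ^+ 2 / n%:R ^+ 2.
have q0 : 0 < q by rewrite divr_gt0 ?exprn_gt0 // mulr_gt0 // exprn_gt0 // (lt_le_trans ltr01).
apply: (conc (fun=> q)) => [//|om hfrac hdev hsum].
set Q := \sum_(x | _) _ * eff_res _ _ _ in hsum.
have Q0 : 0 <= Q by apply: sumr_ge0 => x _; rewrite mulr_ge0 // ltW.
apply: (fin _ _ Q _ Q0 _ (le_trans hsum (bound Q Q0))); last first.
  exact: (sin_angle_avg _ _ _ _ _ _ w_gt0 w_ratio n_gt1 conn pinv _ hfrac hdev).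
have bin_le : 2 * 'C(n, 2)%:R <= n%:R ^+ 2 :> R.
  rewrite -natrX -natrM ler_nat bin2 mul2n.
  apply: (@leq_trans (n * n.-1)); first by rewrite -[leqRHS]odd_double_half leq_addl.
  by rewrite leq_mul // leq_pred.
have avg0 : 0 <= Omega_avg Ldag.
  by rewrite divr_ge0 // sumr_ge0 // => i _; rewrite sumr_ge0.
rewrite /Q -mulr_sumr sum_eff_res // /q.
rewrite [leLHS](_ : _ = 4 * (b ^+ 4 * Omega_avg Ldag) * (2 * 'C(n, 2)%:R / n%:R ^+ 2)); last first.
  by field; rewrite gt_eqF.
rewrite ler_piMr //; last by rewrite ler_pdivrMr ?exprn_gt0 // mul1r.
by rewrite mulr_ge0 // mulr_ge0 // exprn_ge0 // (le_trans ler01).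
Qed.

From mathcomp Require Import Rstruct.

Theorem theorem1 :
  exists c1 c2 c3 C0 : Rdefinitions.R, [/\ 0 < c1, 0 < c2, 0 < c3 & 0 < C0] /\
  forall (n m : nat) (src dst : 'I_m -> 'I_n),
    (2 <= n)%N ->
    simple_graph src dst ->
    connected_graph src dst ->
  forall (Ldag : 'M[Rdefinitions.R]_n),
    is_MP_pinv (laplacian src dst) Ldag ->
  forall (w : 'cV[Rdefinitions.R]_n) (b delta Cnd : Rdefinitions.R) (k : nat),
    (forall i, 0 < w i 0) ->
    (forall i j, w i 0 / w j 0 <= b) ->
    0 < delta -> delta < expR (-1) ->
    c1 * ln (n%:R / delta) <= Cnd ->
    c2 * (E_max src dst)%:R * Cnd ^+ 2 <= k%:R ->
    c3 * Omega_max Ldag * b ^+ 2 * (1 + ln (delta^-1)) <= k%:R ->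
  forall (arb : outcome m k -> 'cV[Rdefinitions.R]_n),
    (forall om, arb om != 0) ->
    1 - delta <=
    Prob src dst w (fun om =>
      sin_angle (estimator src dst Ldag arb om) w ^+ 2 <=
      C0 * Num.min (b ^+ 2 * Omega_max Ldag) (b ^+ 4 * Omega_avg Ldag) / k%:R
         * ((1 + ln (delta^-1)) + (E_max src dst)%:R * Cnd ^+ 2 / k%:R)).
Proof.
have [c1 [c2 [c3 [C0 [c_gt0 H]]]]] := estimator_sin_bound Rdefinitions.R.
exists c1, c2, c3, C0; split=> // n m src dst n2 simple conn Ldag pinv w b delta C k.
move=> w0 wb d0 d1 hC h2 h3 arb _.
exact: (H n m src dst n2 simple conn Ldag pinv w b delta C k w0 wb d0 d1 hC h2 h3 arb).
Qed.
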